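(* Suppose that $(\mathcal{L}(w;\boldsymbol{t}),\tilde{\mathcal{L}}(w;\boldsymbol{t}))$ is a solution of the dToda hierarchy whose dependence on $\boldsymbol{t}=(\ldots,t_{-2},t_{-1},t_0,t_1,t_2,\ldots)$ is through a single variable $\lambda$; that is, there exists a function $\lambda(\boldsymbol{t})$ of $\boldsymbol{t}$ such that $$\mathcal{L}(w;\boldsymbol{t})=\mathcal{L}(w,\lambda(\boldsymbol{t}))=r(\lambda(\boldsymbol{t}))\,w+\sum_{n=0}^{\infty}u_{n+1}(\lambda(\boldsymbol{t}))\,w^{-n},$$ $$\tilde{\mathcal{L}}(w;\boldsymbol{t})^{-1}=\tilde{\mathcal{L}}(w,\lambda(\boldsymbol{t}))^{-1}=r(\lambda(\boldsymbol{t}))\,w^{-1}+\sum_{n=0}^{\infty}\tilde{u}_{n+1}(\lambda(\boldsymbol{t}))\,w^{n}.$$ Then $\mathcal{L}(w,\lambda)$ and $\tilde{\mathcal{L}}(w,\lambda)$ satisfy the radial L\''owner equations with $\phi(\lambda)=\log r(\lambda)$ and with the same function $\sigma(\lambda)$; that is, there is a function $\sigma(\lambda)$, independent of $w$, such that $$\frac{\partial\mathcal{L}(w,\lambda)}{\partial\lambda}=-w\,\frac{\partial\mathcal{L}(w,\lambda)}{\partial w}\,\frac{\sigma(\lambda)+w}{\sigma(\lambda)-w}\,\frac{\partial\phi(\lambda)}{\partial\lambda}\quad\text{(near } w=\infty),$$ $$\frac{\partial\tilde{\mathcal{L}}(w,\lambda)}{\partial\lambda}=-w\,\frac{\partial\tilde{\mathcal{L}}(w,\lambda)}{\partial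 w}\,\frac{\sigma(\lambda)+w}{\sigma(\lambda)-w}\,\frac{\partial\phi(\lambda)}{\partial\lambda}\quad\text{(near } w=0).$$ Moreover, let $p(z,\lambda)$ and $\tilde{p}(z,\lambda)$ be the inverse functions of $\mathcal{L}(w,\lambda)$ and $\tilde{\mathcal{L}}(w,\lambda)$ with respect to $w$, let $\Phi_n(w,\lambda)$ and $\Psi_n(w,\lambda)$, $n\ge1$, be the Faber polynomials of $p(z,\lambda)$ and $\tilde{p}(z,\lambda)$ respectively, and define $\xi_n(\lambda)$, $n\in\mathbb{Z}$, by $$\xi_n(\lambda)=\begin{cases}\sigma(\lambda)\,\Phi_n'(\sigma(\lambda),\lambda), & n\ge1,\\ 1,& n=0,\\ \sigma(\lambda)\,\Psi_{-n}'(\sigma(\lambda),\lambda),& n\le-1,\end{cases}$$ where $'$ denotes $\partial/\partial w$. Then $\lambda(\boldsymbol{t})$ satisfies the hydrodynamic type equation $$\frac{\partial\lambda}{\partial t_n}=\xi_n(\lambda)\,\frac{\partial\lambda}{\partial t_0},\qquad n\in\mathbb{Z}.$$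
   Context: dToda hierarchy. Its unknowns are two formal power series in $w$, $$\mathcal{L}(w;\boldsymbol{t})=r(\boldsymbol{t})w+\sum_{n=0}^{\infty}u_{n+1}(\boldsymbol{t})w^{-n},\qquad \tilde{\mathcal{L}}^{-1}(w;\boldsymbol{t})=r(\boldsymbol{t})w^{-1}+\sum_{n=0}^{\infty}\tilde{u}_{n+1}(\boldsymbol{t})w^n,$$ where $\tilde{\mathcal L}^{-1}=1/\tilde{\mathcal L}$ is the reciprocal and the coefficients are functions of the independent variables $t_n$, $n\in\mathbb{Z}$, denoted collectively by $\boldsymbol{t}$. The pair is a solution of the dToda hierarchy if for all $n\ge1$ $$\frac{\partial\mathcal{L}}{\partial t_n}=\{\mathcal{B}_n,\mathcal{L}\}_T,\quad \frac{\partial\mathcal{L}}{\partial t_{-n}}=\{\tilde{\mathcal{B}}_n,\mathcal{L}\}_T,\quad \frac{\partial\tilde{\mathcal{L}}}{\partial t_n}=\{\mathcal{B}_n,\tilde{\mathcal{L}}\}_T,\quad \frac{\partial\tilde{\mathcal{L}}}{\partial t_{-n}}=\{\tilde{\mathcal{B}}_n,\tilde{\mathcal{L}}\}_T,$$ where $$\mathcal{B}_n=(\mathcal{L}^n)_{>0}+\tfrac12(\mathcal{L}^n)_0,\qquad \tilde{\mathcal{B}}_n=(\tilde{\mathcal{L}}^{-n})_{<0}+\tfrac12(\tilde{\mathcal{L}}^{-n})_0,$$ $$\{h_1,h_2\}_T=w\frac{\partial h_1}{\partial w}\frac{\partial h_2}{\partial t_0}-w\frac{\partial h_1}{\partial t_0}\frac{\partial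 h_2}{\partial w},$$ and for $S\subset\mathbb{Z}$, $(\sum_kA_kw^k)_S=\sum_{k\in S}A_kw^k$ (subscripts $>0$, $0$, $<0$, $\ge0$, $\le0$ denote the corresponding sets of exponents). Inverse functions. $p(z,\lambda)=r^{-1}z+O(1)$ is the formal series near $z=\infty$ inverse under composition to $\mathcal{L}(\cdot,\lambda)$, and $\tilde p(z,\lambda)=rz+O(z^2)$ is the formal power series near $z=0$ inverse under composition to $\tilde{\mathcal{L}}(\cdot,\lambda)$. Faber polynomials. $\Phi_n(w,\lambda)$ (polynomial in $w$) and $\Psi_n(w,\lambda)$ (polynomial in $w^{-1}$), $n\ge1$, are defined by $$\log\frac{p(z,\lambda)-w}{r^{-1}z}=-\sum_{n=1}^{\infty}\frac{\Phi_n(w,\lambda)}{n}z^{-n},\qquad \log\frac{w-\tilde{p}(z,\lambda)}{w}=\log\frac{\tilde{p}(z,\lambda)}{rz}-\sum_{n=1}^{\infty}\frac{\Psi_n(w,\lambda)}{n}z^n;$$ equivalently $\Phi_n=(\mathcal{L}^n)_{\ge0}$ and $\Psi_n=(\tilde{\mathcal{L}}^{-n})_{\le0}$. The L\''owner equations are read as identities of formal series, the factor $\frac{\sigma+w}{\sigma-w}$ being expanded in powers of $w^{-1}$ in the equation for $\mathcal{L}$ and in powers of $w$ in the equation for $\tilde{\mathcal{L}}$.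
   Formalization: The claim fails if the series do not vary with λ or λ(t) is constant; added: the λ-values considered form an open set, each is attained at a time where some ∂λ/∂t_n is nonzero, and at each the pair of series has nonzero λ-derivative; r is nonzero. *)

(* Defs.v *)
From HB Require Import structures.
From mathcomp Require Import all_boot all_order all_algebra.
From mathcomp Require Import all_classical all_reals all_analysis.

Set Implicit Arguments.
Unset Strict Implicit.
Unset Printing Implicit Defensive.

Import Order.TTheory GRing.Theory Num.Theory.
Import numFieldNormedType.Exports.

Local Open Scope classical_set_scope.
Local Open Scope ring_scope.

(* A formal series \sum_k a_k w^k is its coefficient function [a : int -> A]. *)
Definition fseries (A : Type) := int -> A.

Definition laurent_inf {A : nzRingType} (a : fseries A) : Prop :=
  exists N : int, forall k, N < k -> a k = 0.

Definition laurent_zero {A : nzRingType} (a : fseries A) : Prop :=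
  exists N : int, forall k, k < N -> a k = 0.

Definition smono {A : nzRingType} (c : A) (m : int) : fseries A :=
  fun k => if k == m then c else 0.

(* The Cauchy product.  [\sum_(i \in _)] is a sum over the finite support of
   the summand; the support is finite whenever both factors are Laurent at the
   same point, or one factor is a Laurent polynomial. *)
Definition smul {A : nzRingType} (a b : fseries A) : fseries A :=
  fun k => \sum_(i \in [set: int]) a i * b (k - i).

Notation "a ** b" := (smul a b) (at level 40, left associativity).

Definition spow {A : nzRingType} (a : fseries A) (n : nat) : fseries A :=
  iter n (smul a) (smono 1 0).

(* The reciprocal of a series, expanded at w = oo or at w = 0; it is unique
   when it exists (over a field: for every nonzero Laurent series there). *)
Definition srecip_inf {A : nzRingType} (a : fseries A) : fseries A :=
  xget (fun=> 0) [set b : int -> A | laurent_inf b /\ a ** b = smono 1 0].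

Definition srecip_zero {A : nzRingType} (a : fseries A) : fseries A :=
  xget (fun=> 0) [set b : int -> A | laurent_zero b /\ a ** b = smono 1 0].

(* Integer powers, with the negative ones expanded at w = oo or at w = 0. *)
Definition spowz_inf {A : nzRingType} (a : fseries A) (k : int) : fseries A :=
  match k with
  | Posz n => spow a n
  | Negz n => spow (srecip_inf a) n.+1
  end.

Definition spowz_zero {A : nzRingType} (a : fseries A) (k : int) : fseries A :=
  match k with
  | Posz n => spow a n
  | Negz n => spow (srecip_zero a) n.+1
  end.

(* The composition \sum_k a_k b(z)^k. *)
Definition scomp_inf {A : nzRingType} (a b : fseries A) : fseries A :=
  fun m => \sum_(k \in [set: int]) a k * spowz_inf b k m.

Definition scomp_zero {A : nzRingType} (a b : fseries A) : fseries A :=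
  fun m => \sum_(k \in [set: int]) a k * spowz_zero b k m.

(* w d/dw *)
Definition swdw {A : nzRingType} (a : fseries A) : fseries A :=
  fun k => k%:~R * a k.

Definition sproj {A : nzRingType} (S : pred int) (a : fseries A) : fseries A :=
  fun k => if S k then a k else 0.

Section DispersionlessToda.
Context {K : numFieldType}.

(* L = r w + \sum_(n >= 0) u_n w^(-n); [u n] is the coefficient usually
   numbered n + 1. *)
Definition toda_L (r : K) (u : nat -> K) : fseries K :=
  fun k => if k == 1 then r else if k <= 0 then u `|k|%N else 0.

(* 1 / Ltilde = r w^(-1) + \sum_(n >= 0) v_n w^n *)
Definition toda_Ltinv (r : K) (v : nat -> K) : fseries K :=
  fun k => if k == -1 then r else if 0 <= k then v `|k|%N else 0.

Definition toda_Lt (r : K) (v : nat -> K) : fseries K :=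
  srecip_zero (toda_Ltinv r v).

(* The values of all the independent variables t_n, n in Z. *)
Definition times := int -> K.

Definition set_time (t : times) (n : int) (x : K) : times :=
  fun m => if m == n then x else t m.

Definition time_derivable (n : int) (f : times -> K) (t : times) : Prop :=
  derivable (fun x : K => f (set_time t n x)) (t n) 1.

Definition time_deriv (n : int) (f : times -> K) (t : times) : K :=
  derive1 (fun x : K => f (set_time t n x)) (t n).

(* Openness along every coordinate line: what partial derivatives need. *)
Definition time_open (D : set times) : Prop :=
  forall t, D t -> forall n : int, \forall x \near t n, D (set_time t n x).

Definition stime_deriv (n : int) (h : times -> fseries K) (t : times) :
    fseries K :=
  fun k => time_deriv n (fun s => h s k) t.

Definition poisson (h1 h2 : times -> fseries K) (t : times) : fseries K :=
  fun k => (swdw (h1 t) ** stime_deriv 0 h2 t) k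
         - (stime_deriv 0 h1 t ** swdw (h2 t)) k.

Definition toda_B (n : nat) (L : fseries K) : fseries K :=
  fun k => sproj (fun i => 0 < i) (spow L n) k
         + 2^-1 * sproj (fun i => i == 0) (spow L n) k.

(* The second argument is 1 / Ltilde. *)
Definition toda_Bt (n : nat) (Ltinv : fseries K) : fseries K :=
  fun k => sproj (fun i => i < 0) (spow Ltinv n) k
         + 2^-1 * sproj (fun i => i == 0) (spow Ltinv n) k.

Definition dToda_solution (D : set times)
    (r : times -> K) (u v : nat -> times -> K) : Prop :=
  let L := fun t => toda_L (r t) (u ^~ t) in
  let Ltinv := fun t => toda_Ltinv (r t) (v ^~ t) in
  let Lt := fun t => toda_Lt (r t) (v ^~ t) in
  [/\ forall t, D t -> r t != 0,
      forall t, D t -> forall n : int,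
        [/\ time_derivable n r t,
            forall k, time_derivable n (u k) t &
            forall k, time_derivable n (v k) t] &
      forall t, D t -> forall n : nat, (0 < n)%N ->
        [/\ stime_deriv n%:Z L t = poisson (fun s => toda_B n (L s)) L t,
            stime_deriv (- n%:Z) L t = poisson (fun s => toda_Bt n (Ltinv s)) L t,
            stime_deriv n%:Z Lt t = poisson (fun s => toda_B n (L s)) Lt t &
            stime_deriv (- n%:Z) Lt t =
              poisson (fun s => toda_Bt n (Ltinv s)) Lt t]].

Definition is_inverse_inf (r : K) (L p : fseries K) : Prop :=
  [/\ p 1 = r^-1, forall k, 1 < k -> p k = 0,
      scomp_inf L p = smono 1 1 & scomp_inf p L = smono 1 1].

Definition is_inverse_zero (r : K) (Lt pt : fseries K) : Prop :=
  [/\ pt 1 = r, forall k, k < 1 -> pt k = 0,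
      scomp_zero Lt pt = smono 1 1 & scomp_zero pt Lt = smono 1 1].

(* log x = \sum_(j >= 1) (-1)^(j-1) (x - 1)^j / j, meant for x - 1 a series in
   z (or in z^(-1)) without constant term: each coefficient is then a finite
   sum. *)
Definition slog (x : fseries {poly K}) : fseries {poly K} :=
  fun k => \sum_(j \in [set: nat])
    ((-1) ^+ j / j.+1%:R) *: spow (fun i => x i - smono 1 0 i) j.+1 k.

(* Phi_n as a polynomial in w, read off from
   log ((p(z) - w) / (r^-1 z)) = - \sum_(n >= 1) Phi_n(w) / n z^(-n). *)
Definition faber_Phi (r : K) (p : fseries K) (n : nat) : {poly K} :=
  let x : fseries {poly K} :=
    fun k => r *: ((p (k + 1))%:P - smono 'X 0 (k + 1)) in
  - n%:R *: slog x (- n%:Z).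

(* Psi_n as a polynomial in the variable w^(-1), denoted 'X here, read off from
   log ((w - pt(z)) / w) = log (pt(z) / (r z)) - \sum_(n >= 1) Psi_n(w) / n z^n. *)
Definition faber_Psi (r : K) (pt : fseries K) (n : nat) : {poly K} :=
  let x : fseries {poly K} := fun k => smono 1 0 k - pt k *: 'X in
  let y : fseries {poly K} := fun k => (r^-1 * pt (k + 1))%:P in
  - n%:R *: (slog x n%:Z - slog y n%:Z).

(* For n < 0 the polynomial P = Psi_(-n) is in w^(-1), so that
   d/dw P(w^(-1)) = - w^(-2) P'(w^(-1)). *)
Definition xi (r : K) (p pt : fseries K) (s : K) (n : int) : K :=
  match n with
  | Posz 0 => 1
  | Posz m.+1 => s * ((faber_Phi r p m.+1)^`()).[s]
  | Negz m => s * (- s ^- 2 * ((faber_Psi r pt m.+1)^`()).[s^-1])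
  end.

(* (s + w) / (s - w), expanded at w = oo and at w = 0 respectively. *)
Definition kernel_inf (s : K) : fseries K :=
  (fun k => smono s 0 k + smono 1 1 k)
  ** srecip_inf (fun k => smono s 0 k - smono 1 1 k).

Definition kernel_zero (s : K) : fseries K :=
  (fun k => smono s 0 k + smono 1 1 k)
  ** srecip_zero (fun k => smono s 0 k - smono 1 1 k).

(* The derivative of log r; it does not depend on a branch of the logarithm. *)
Definition dlog (r : K -> K) (l : K) : K := derive1 r l / r l.

Definition slambda_deriv (h : K -> fseries K) (l : K) : fseries K :=
  fun k => derive1 (fun m : K => h m k) l.

Definition loewner_inf (r : K -> K) (L : K -> fseries K) (s l : K) : Prop :=
  slambda_deriv L l = fun k => - (swdw (L l) ** kernel_inf s) k * dlog r l.

Definition loewner_zero (r : K -> K) (Lt : K -> fseries K) (s l : K) : Prop :=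
  slambda_deriv Lt l = fun k => - (swdw (Lt l) ** kernel_zero s) k * dlog r l.

End DispersionlessToda.

Arguments times : clear implicits.

(* Main.v *)
From HB Require Import structures.
Require Import Defs.
From mathcomp Require Import all_boot all_order all_algebra.
From mathcomp Require Import all_classical all_reals all_analysis.
From mathcomp Require Import zify ring.

Import Order.TTheory GRing.Theory Num.Theory.
Import numFieldNormedType.Exports.

Set Implicit Arguments.
Unset Strict Implicit.
Unset Printing Implicit Defensive.

Local Open Scope classical_set_scope.
Local Open Scope ring_scope.

(** A solution of the hierarchy that depends on the times through one variable
    [lambda] obeys, for each time [t_n], an equation
      [a_n L' = a_0 (w dB_n/dw) L' - X_n (w dL/dw)],
    where [a_n] is the derivative of [lambda] along [t_n], the prime is
    [d/dlambda] and [X_n] is the [t_0]-derivative of the Hamiltonian [B_n]; the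
    reciprocal [h] of the second series obeys the same equation.  The whole
    argument uses of [X_n] only that it is a Laurent polynomial with exponents
    between 0 and [n] (between [-n] and 0 for the negative times).

    If [a_0 = 0], comparing degrees at one end makes [X_n] a constant, and the
    leading coefficients of [L] and [h], which are both [r], force it to
    vanish; then [a_n L'] and [a_n h'] vanish, hence so does [a_n], as [L'] and
    [h'] are not both zero ([reduced_flow_stationary]).  If [a_0] is nonzero,
    the three leading coefficients of the two equations at [n = 1] determine
    [X_1], and what remains are the Loewner equations with
    [sigma = u' / (2 r')], where [u] is the constant term of [L]
    ([reduced_flow1]).  Substituting them in the n-th equation and cancelling
    [w dL/dw] leaves an identity of Laurent polynomials in which [X_n] is
    multiplied by [sigma - w]; at [w = sigma] it reads
    [a_n = a_0 (w dB_n/dw)(sigma)] ([reduced_flow_speed]).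

    It remains to see that [w dB_n/dw] is [w] times the derivative of the n-th
    Faber polynomial.  Differentiating the generating logarithm turns it into a
    geometric series, so that the coefficients of the derivative are
    coefficients of powers of the inverse functions ([deriv_slog]); Lagrange
    inversion identifies them with the coefficients of [L ^ n]
    ([lagrange_inversion]).

    All of this is computed in the field of formal Laurent series at zero.  A
    series at infinity is a series at zero in the variable [w^-1], and under this
    reflection [L] and [h] have the same shape [r w^-1 + ...], so that each
    lemma on a single series serves both ends, and the negative times are the
    positive ones with the two series exchanged. *)

(** * Laurent series *)

Definition vanish_below {A : nzRingType} (N : int) (a : fseries A) : Prop :=
  forall k, k < N -> a k = 0.

(** Every infinite sum below is reduced to a sum over a common finite window,
    where the lemmas on ordinary big operators apply. *)
Lemma fsum_window (A : nmodType) (F : int -> A) (N : int) (n : nat) :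
  (forall i, i < N \/ N + n%:Z <= i -> F i = 0) ->
  \sum_(i \in [set: int]) F i = \sum_(i < n) F (N + i%:Z).
Proof.
move=> F0; pose s := [seq N + j%:Z | j <- iota 0 n].
have us : uniq s by rewrite map_inj_uniq ?iota_uniq// => i j /addrI [].
rewrite (fsbigE s) => //.
  rewrite big_mkcond /s big_map -{1}[n]subn0 big_mkord.
  by apply: eq_bigr => i _; rewrite in_setT.
move=> i _ iNs; apply: F0; have [iN|Ni] := boolP (i < N); first by left.
right; rewrite leNgt; apply: contra iNs => iNn; apply/mapP.
by exists `|(i - N)%R|%N; rewrite ?mem_iota; lia.
Qed.

Lemma smul_window (A : nzRingType) (a b : fseries A) (k N : int) (n : nat) :
  (forall i, i < N -> a i = 0) -> (forall i, N + n%:Z <= i -> b (k - i) = 0) ->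
  (a ** b) k = \sum_(i < n) a (N + i%:Z) * b (k - (N + i%:Z)).
Proof.
move=> a0 b0; apply: fsum_window => i [/a0->|/b0->]; rewrite ?mul0r ?mulr0 //.
Qed.

Lemma smulC (A : comNzRingType) (a b : fseries A) : a ** b = b ** a.
Proof.
apply/funext => k; rewrite /smul (reindex_fsbigT (fun i : int => k - i)).
  by apply: eq_fsbigr => i _; rewrite mulrC opprB addrC subrK.
by exists (fun i => k - i) => i; lia.
Qed.

Lemma vanish_below_mul (A : nzRingType) (a b : fseries A) (N M : int) :
  vanish_below N a -> vanish_below M b -> vanish_below (N + M) (a ** b).
Proof.
move=> a0 b0 k kNM; rewrite (@smul_window _ _ _ k N 0) ?big_ord0// => i Ni.
by apply: b0; lia.
Qed.

Lemma smul_lead (A : nzRingType) (a b : fseries A) (N M : int) :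
  vanish_below N a -> vanish_below M b -> (a ** b) (N + M) = a N * b M.
Proof.
move=> a0 b0; rewrite (@smul_window _ _ _ _ N 1)//.
  by rewrite big_ord1 addr0 addrAC subrr add0r.
by move=> i Ni; apply: b0; lia.
Qed.

Lemma smulDl (A : nzRingType) (a b c : fseries A) :
  laurent_zero a -> laurent_zero b -> laurent_zero c ->
  (a + b) ** c = a ** c + b ** c.
Proof.
move=> [Na a0] [Nb b0] [Nc c0]; apply/funext => k.
pose N : int := Num.min Na Nb; pose n := `|(k - N - Nc)%R|%N.+1.
have cn i : N + n%:Z <= i -> c (k - i) = 0 by move=> ?; apply: c0; lia.
have aN i : i < N -> a i = 0 by move=> ?; apply: a0; lia.
have bN i : i < N -> b i = 0 by move=> ?; apply: b0; lia.
have abN i : i < N -> (a + b) i = 0 by move=> iN; rewrite fctE aN// bN// addr0.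
rewrite -[RHS]/((a ** c) k + (b ** c) k) !(@smul_window _ _ _ k N n)// -big_split.
by apply: eq_bigr => i _; rewrite fctE mulrDl.
Qed.

Lemma smulA (A : nzRingType) (a b c : fseries A) :
  laurent_zero a -> laurent_zero b -> laurent_zero c ->
  a ** (b ** c) = (a ** b) ** c.
Proof.
move=> [Na a0] [Nb b0] [Nc c0]; apply/funext => k.
pose n := `|(k - Na - Nb - Nc)%R|%N.+1.
have bc0 := vanish_below_mul b0 c0; have ab0 := vanish_below_mul a0 b0.
rewrite (@smul_window _ a _ k Na n)//; last by move=> i ?; apply: bc0; lia.
rewrite (@smul_window _ _ c k (Na + Nb) n)//; last by move=> i ?; apply: c0; lia.
(* The window of [b ** c] is shifted by [- i], so that the double sum is over a
   square and its two orders of summation can be exchanged. *)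
transitivity (\sum_(i < n) \sum_(j < n) a (Na + i%:Z) *
    (b (Nb - i%:Z + j%:Z) * c (k - (Na + Nb + j%:Z)))).
  apply: eq_bigr => i _; rewrite (@smul_window _ b c _ (Nb - i%:Z) n).
  - rewrite mulr_sumr; apply: eq_bigr => j _; congr (_ * (_ * c _)); lia.
  - by move=> j ?; apply: b0; lia.
  - by move=> j ?; apply: c0; lia.
rewrite exchange_big; apply: eq_bigr => j _.
rewrite (@smul_window _ a b _ Na n)//; last first.
  by move=> i ?; apply: b0; have := ltn_ord j; lia.
rewrite mulr_suml; apply: eq_bigr => i _; rewrite mulrA; congr (_ * b _ * _); lia.
Qed.

Lemma smul_smono (A : nzRingType) (c : A) (m : int) (a : fseries A) k :
  (smono c m ** a) k = c * a (k - m).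
Proof.
rewrite /smul (@fsum_window _ _ m 1); first by rewrite big_ord1 addr0 /smono eqxx.
by move=> i i1; rewrite /smono; case: eqP; rewrite ?mul0r //; lia.
Qed.

Lemma smono0K (A : nzRingType) (a : fseries A) : smono 1 0 ** a = a.
Proof. by apply/funext => k; rewrite smul_smono subr0 mul1r. Qed.

Section LaurentRing.
Variable A : comNzRingType.

Definition laurent_pred : {pred fseries A} := fun a => `[< laurent_zero a >].

Fact laurent_zmod_closed : zmod_closed laurent_pred.
Proof.
split=> [|a b /asboolP[N a0] /asboolP[M b0]]; apply/asboolP; first by exists 0.
exists (Num.min N M) => k kNM; rewrite !fctE a0 ?b0 ?subr0//; lia.
Qed.

HB.instance Definition _ :=
  GRing.isZmodClosed.Build (fseries A) laurent_pred laurent_zmod_closed.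

(** Making boundedness below part of the type turns the product into a ring
    operation, and over a field into a field operation. *)
Record laurent := Laurent { lcoef :> int -> A; _ : lcoef \in laurent_pred }.

HB.instance Definition _ := [isSub for lcoef].
HB.instance Definition _ := [Choice of laurent by <:].
HB.instance Definition _ := [SubChoice_isSubZmodule of laurent by <:].

Lemma laurentP (x y : laurent) : (forall k, x k = y k) -> x = y.
Proof. by move=> xy; apply/val_inj/funext. Qed.

Lemma laurent_bounded (x : laurent) : laurent_zero x.
Proof. by case: x => a /= /asboolP. Qed.

Definition to_laurent (a : fseries A) (a0 : laurent_zero a) : laurent :=
  @Laurent a (asboolT a0).

Lemma smono_bounded (c : A) m : laurent_zero (smono c m).
Proof. by exists m => k km; rewrite /smono lt_eqF. Qed.

Definition lmono (c : A) (m : int) : laurent := to_laurent (smono_bounded c m).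

Lemma smul_bounded (a b : fseries A) :
  laurent_zero a -> laurent_zero b -> laurent_zero (a ** b).
Proof. by move=> [N a0] [M b0]; exists (N + M); exact: vanish_below_mul. Qed.

Definition lmul (x y : laurent) : laurent :=
  to_laurent (smul_bounded (laurent_bounded x) (laurent_bounded y)).

Fact lmulA : associative lmul.
Proof. by move=> x y z; apply/val_inj/smulA; exact: laurent_bounded. Qed.

Fact lmulC : commutative lmul.
Proof. by move=> x y; apply/val_inj/smulC. Qed.

Fact lmul1 : left_id (lmono 1 0) lmul.
Proof. by move=> x; apply/val_inj/smono0K. Qed.

Fact lmulDl : left_distributive lmul +%R.
Proof. by move=> x y z; apply/val_inj/smulDl; exact: laurent_bounded. Qed.

Fact lmono1_neq0 : lmono 1 0 != 0.
Proof.
apply/eqP => /(congr1 (fun x : laurent => x 0)) /eqP.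
by rewrite /= /smono eqxx (negbTE (oner_neq0 A)).
Qed.

HB.instance Definition _ := GRing.Zmodule_isComNzRing.Build laurent
  lmulA lmulC lmul1 lmulDl lmono1_neq0.

Lemma lcoefD (x y : laurent) k : (x + y) k = x k + y k. Proof. by []. Qed.
Lemma lcoefN (x : laurent) k : (- x) k = - x k. Proof. by []. Qed.
Lemma lcoefB (x y : laurent) k : (x - y) k = x k - y k. Proof. by []. Qed.

Lemma lcoef0 k : (0 : laurent) k = 0. Proof. by []. Qed.

Lemma lcoef_sum I (s : seq I) (P : pred I) (F : I -> laurent) k :
  (\sum_(i <- s | P i) F i) k = \sum_(i <- s | P i) F i k.
Proof. by elim/big_rec2: _ => // i y x _ <-. Qed.

Lemma lcoefM (x y : laurent) : x * y = (x : fseries A) ** y :> fseries A.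
Proof. by []. Qed.

Lemma lcoef1 : (1 : laurent) = smono 1 0 :> fseries A. Proof. by []. Qed.

Lemma lcoefX (x : laurent) n : x ^+ n = spow x n :> fseries A.
Proof. by elim: n => [|n IH]; rewrite ?expr0 // exprS lcoefM IH. Qed.

Lemma lmonoE c m k : lmono c m k = if k == m then c else 0. Proof. by []. Qed.

Lemma lcoef_lmonoM c m (x : laurent) k : (lmono c m * x) k = c * x (k - m).
Proof. exact: smul_smono. Qed.

Lemma lmonoM c d m n : lmono c m * lmono d n = lmono (c * d) (m + n).
Proof.
apply/laurentP => k; rewrite lcoef_lmonoM !lmonoE subr_eq (addrC n).
by case: ifP; rewrite ?mulr0.
Qed.

Lemma lmonoX m n : lmono 1 m ^+ n = lmono 1 (m *+ n).
Proof.
by elim: n => [|n IH]; rewrite ?expr0 ?mulr0n// exprS IH lmonoM mulr1 mulrS.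
Qed.

Definition lconst (c : A) := lmono c 0.

Fact lconst_zmod_morphism : zmod_morphism lconst.
Proof.
move=> c d; apply/laurentP => k; rewrite lcoefB !lmonoE.
by case: ifP; rewrite ?subr0.
Qed.

Fact lconst_monoid_morphism : monoid_morphism lconst.
Proof. by split=> // c d; rewrite /lconst lmonoM addr0. Qed.

HB.instance Definition _ :=
  GRing.isZmodMorphism.Build A laurent lconst lconst_zmod_morphism.
HB.instance Definition _ :=
  GRing.isMonoidMorphism.Build A laurent lconst lconst_monoid_morphism.

Lemma lcoef_lconstM c (x : laurent) k : (lconst c * x) k = c * x k.
Proof. by rewrite lcoef_lmonoM subr0. Qed.

Implicit Types (x y : laurent) (N M : int).

Lemma vanish_belowW N M x : M <= N -> vanish_below N x -> vanish_below M x.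
Proof. by move=> MN x0 k kM; apply: x0; exact: lt_le_trans MN. Qed.

Lemma vanish_belowD N x y :
  vanish_below N x -> vanish_below N y -> vanish_below N (x + y).
Proof. by move=> x0 y0 k kN; rewrite lcoefD x0// y0// addr0. Qed.

Lemma vanish_belowN N x : vanish_below N x -> vanish_below N (- x).
Proof. by move=> x0 k kN; rewrite lcoefN x0// oppr0. Qed.

Lemma vanish_belowB N x y :
  vanish_below N x -> vanish_below N y -> vanish_below N (x - y).
Proof. by move=> x0 y0; apply: vanish_belowD => //; exact: vanish_belowN. Qed.

Lemma vanish_below_sum N I (s : seq I) (P : pred I) (F : I -> laurent) :
  (forall i, P i -> vanish_below N (F i)) ->
  vanish_below N (\sum_(i <- s | P i) F i).
Proof.
by move=> F0 k kN; rewrite lcoef_sum big1// => i Pi; exact: F0.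
Qed.

Lemma vanish_belowM N M x y :
  vanish_below N x -> vanish_below M y -> vanish_below (N + M) (x * y).
Proof. exact: vanish_below_mul. Qed.

Lemma lcoefM_lead N M x y : vanish_below N x -> vanish_below M y ->
  (x * y) (N + M) = x N * y M.
Proof. exact: smul_lead. Qed.

Lemma vanish_below_lmono c m : vanish_below m (lmono c m).
Proof. by move=> k km; rewrite lmonoE lt_eqF. Qed.

Lemma vanish_belowX N x n : vanish_below N x -> vanish_below (N *+ n) (x ^+ n).
Proof.
move=> x0; elim: n => [|n IH]; first exact: vanish_below_lmono.
by rewrite exprS mulrS; exact: vanish_belowM.
Qed.

Lemma laurent_lead x : x != 0 -> exists2 N, vanish_below N x & x N != 0.
Proof.
move=> x_neq0; have [N0 x0] := laurent_bounded x.
have /existsNP[k xk] : ~ forall k, x k = 0.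
  by move=> x00; move/eqP: x_neq0; apply; apply/laurentP => k; rewrite x00.
have exn : exists n, x (N0 + n%:Z) != 0.
  have N0k : N0 <= k by rewrite leNgt; apply/negP => /x0.
  exists `|(k - N0)%R|%N; apply/eqP; rewrite (_ : N0 + _ = k)//; lia.
case: (ex_minnP exn) => n xn n_min; exists (N0 + n%:Z) => // i iN.
have [/x0//|N0i] := ltP i N0; apply/eqP/negPn/negP => xi.
have /n_min : x (N0 + `|(i - N0)%R|%N) != 0 by rewrite (_ : N0 + _ = i)//; lia.
lia.
Qed.

Lemma srecip_zeroP x y : x * y = 1 -> srecip_zero x = y.
Proof.
move=> xy; apply: xget_unique => [|b [bN xb]].
  by split; [exact: laurent_bounded | rewrite -lcoefM xy].
have xb1 : x * to_laurent bN = 1 by apply/val_inj.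
suff : to_laurent bN = y by move=> <-.
by rewrite -[LHS]mul1r -xy (mulrC x) -mulrA xb1 mulr1.
Qed.
End LaurentRing.

Lemma laurent_unit (K : fieldType) (x : laurent K) :
  x != 0 -> exists y, x * y = 1.
Proof.
move=> /laurent_lead[N x0 xN].
(* After normalization [x] is [1 - z] with [z] divisible by the variable; the
   inverse is the geometric series in [z]. *)
pose c := lmono (x N)^-1 (- N).
have [z zE] : exists z : laurent K, z = 1 - c * x by exists (1 - c * x).
have z0 : vanish_below 1 z.
  move=> k k1; rewrite zE lcoefB lcoef1 lcoef_lmonoM opprK /smono.
  have [->|k_neq0] := eqVneq k 0; first by rewrite add0r mulVf// subrr.
  rewrite (x0 (k + N)) ?mulr0 ?subr0//; lia.
have zX n : vanish_below n%:Z (z ^+ n).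
  by have := vanish_belowX (n := n) z0; rewrite -natz.
pose s : fseries K := fun k => \sum_(j < `|k|%N.+1) (z ^+ j) k.
have sE k (M : nat) : k < M%:Z -> s k = (\sum_(j < M) z ^+ j) k.
  move=> kM; rewrite lcoef_sum; have [k0|k0] := ltP k 0.
    by rewrite /s !big1 // => i _; apply: zX; exact: lt_le_trans k0 _.
  have kM' : (`|k| < M)%N by lia.
  rewrite /s (big_ord_widen_cond _ (fun=> true) (fun j => (z ^+ j) k) kM').
  rewrite [RHS](bigID (fun i : 'I_M => (i < `|k|.+1)%N)) /=.
  rewrite [X in _ + X]big1 ?addr0// => i; rewrite -leqNgt => ki; apply: zX; lia.
have s0 : laurent_zero s.
  by exists 0 => k k0; rewrite (sE k 0)// big_ord0.
have zs : (1 - z) * to_laurent s0 = 1.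
  apply/laurentP => k.
  pose M := `|k|.+1; pose sM : laurent K := \sum_(j < M) z ^+ j.
  have -> : (1 - z) * to_laurent s0
          = 1 - z ^+ M + (1 - z) * (to_laurent s0 - sM).
    have sME : (1 - z) * sM = 1 - z ^+ M by rewrite -opprB mulNr -subrX1 opprB.
    by rewrite mulrBr sME [RHS]addrC subrK.
  have kM : k < M%:Z by lia.
  rewrite lcoefD lcoefB zX// subr0.
  have szM : vanish_below M%:Z (to_laurent s0 - sM).
    by move=> i iM; rewrite lcoefB -sE// subrr.
  have z1 : vanish_below 0 (1 - z).
    by apply: vanish_belowB; [exact: vanish_below_lmono|exact: vanish_belowW z0].
  by rewrite (vanish_belowM z1 szM) ?addr0// add0r.
by exists (c * to_laurent s0); rewrite mulrA -zs zE opprB addrC subrK (mulrC c).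
Qed.

Section LaurentField.
Variable K : fieldType.

Fact srecip_zero_bounded (x : laurent K) : laurent_zero (srecip_zero x).
Proof.
have [->|/laurent_unit[y /srecip_zeroP->]] := eqVneq x 0; last first.
  exact: laurent_bounded.
rewrite /srecip_zero; case: xgetP => [_ _ []//|_]; exact: (laurent_bounded 0).
Qed.

(** Also [srecip_zero 0 = 0], so that the inverse of the field is the reciprocal
    everywhere. *)
Definition linv (x : laurent K) : laurent K :=
  to_laurent (srecip_zero_bounded x).

Fact lmulVf (x : laurent K) : x != 0 -> linv x * x = 1.
Proof.
move=> /laurent_unit[y xy]; rewrite (_ : linv x = y) ?(mulrC y)//.
exact/val_inj/srecip_zeroP.
Qed.

Fact linv0 : linv 0 = 0.
Proof.
apply/val_inj; rewrite /= /srecip_zero; case: xgetP => [b _ [bN b0]|//].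
have /eqP : 0 * to_laurent bN = 1 :> laurent K by apply/val_inj.
by rewrite mul0r eq_sym oner_eq0.
Qed.

HB.instance Definition _ :=
  GRing.ComNzRing_isField.Build (laurent K) lmulVf linv0.

Lemma lcoefV (x : laurent K) : x^-1 = srecip_zero x :> fseries K.
Proof. by []. Qed.

Lemma spowz_zeroE (x : laurent K) k : x ^ k = spowz_zero x k :> fseries K.
Proof.
case: k => n; first by rewrite lcoefX.
by rewrite /spowz_zero -lcoefV -lcoefX exprVn.
Qed.
End LaurentField.

(** * Coefficientwise maps and derivations *)

Section CoefMap.
Variables (A B : comNzRingType) (e : int -> A -> B).
Hypothesis e_add : forall k, zmod_morphism (e k).

Let e0 k : e k 0 = 0.
Proof. by rewrite -(subrr 0) e_add subrr. Qed.

Fact coefmap_bounded (x : laurent A) : laurent_zero (fun k => e k (x k)).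
Proof. by have [N x0] := laurent_bounded x; exists N => k /x0->. Qed.

Definition coefmap (x : laurent A) : laurent B :=
  to_laurent (coefmap_bounded x).

Lemma vanish_below_coefmap N (x : laurent A) :
  vanish_below N x -> vanish_below N (coefmap x).
Proof. by move=> x0 k /x0 xk; rewrite /= xk. Qed.

Lemma coefmap_is_zmod_morphism : zmod_morphism coefmap.
Proof. by move=> x y; apply/laurentP => k; exact: e_add. Qed.

Lemma coefmap_fsum n (F : 'I_n -> A) k : e k (\sum_i F i) = \sum_i e k (F i).
Proof.
pose ek : {additive A -> B} :=
  HB.pack (e k) (GRing.isZmodMorphism.Build _ _ _ (e_add k)).
exact: (raddf_sum ek).
Qed.
End CoefMap.

(** The product of series is bilinear in the coefficients, so a map acting on
    them is a derivation as soon as it is one on monomials.  This gives both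
    [w d/dw] and the derivation with respect to a parameter in the
    coefficients. *)
Lemma coefmap_leibniz (A : comNzRingType) (e : int -> A -> A)
    (e_add : forall k, zmod_morphism (e k)) :
  (forall i j a b, e (i + j) (a * b) = e i a * b + a * e j b) ->
  forall x y : laurent A,
    coefmap e_add (x * y) = coefmap e_add x * y + x * coefmap e_add y.
Proof.
move=> e_leibniz x y; apply/laurentP => k.
have [N x0] := laurent_bounded x; have [M y0] := laurent_bounded y.
pose n := `|(k - N - M)%R|%N.+1.
have dx0 := vanish_below_coefmap e_add x0.
have dy0 := vanish_below_coefmap e_add y0.
have kM i : N + n%:Z <= i -> k - i < M by rewrite /n; lia.
rewrite lcoefD -[LHS]/(e k ((x * y) k)) !lcoefM !(@smul_window _ _ _ k N n)//.
- rewrite (coefmap_fsum e_add) -big_split; apply: eq_bigr => i _ /=.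
  by rewrite -e_leibniz; congr (e _ _); lia.
- by move=> i /kM /dy0.
- by move=> i /kM /y0.
- by move=> i /kM /y0.
Qed.

Section Derivation.
Variables (A : comNzRingType) (d : A -> A).
Hypothesis d_leibniz : forall x y, d (x * y) = d x * y + x * d y.

Lemma derivation1 : d 1 = 0.
Proof.
by apply: (@addrI _ (d 1)); rewrite -{3}[1]mulr1 d_leibniz mulr1 mul1r addr0.
Qed.

Lemma derivationX x n : d (x ^+ n.+1) = n.+1%:R * x ^+ n * d x.
Proof.
elim: n => [|n IH]; first by rewrite !expr1 expr0 !mul1r.
rewrite exprS d_leibniz IH [n.+2%:R]mulrSr !exprS; ring.
Qed.
End Derivation.

Lemma derivationXz (F : fieldType) (d : F -> F) :
  (forall x y, d (x * y) = d x * y + x * d y) ->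
  forall x k, x != 0 -> d (x ^ k) = k%:~R * x ^ k * (d x / x).
Proof.
move=> d_leibniz x k x0; have d1 := derivation1 d_leibniz.
have dXn n : d (x ^+ n) = n%:R * x ^+ n * (d x / x).
  case: n => [|n]; first by rewrite expr0 d1 !mul0r.
  by rewrite derivationX// exprS; field.
case: k => n; first exact: dXn.
have xn0 : x ^+ n.+1 != 0 by rewrite expf_neq0.
have : d (x ^+ n.+1 * x ^ Negz n) = 0 by rewrite divff// d1.
rewrite d_leibniz dXn => /(canRL (addKr _)); rewrite addr0 => e.
apply: (mulfI xn0); rewrite e NegzE mulrNz; ring.
Qed.

Section EulerDerivation.
Variable A : comNzRingType.

Fact euler_zmod_morphism (k : int) : zmod_morphism (fun a : A => k%:~R * a).
Proof. by move=> a b; rewrite mulrBr. Qed.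

Definition lwdw : laurent A -> laurent A := coefmap euler_zmod_morphism.

HB.instance Definition _ := GRing.isZmodMorphism.Build (laurent A) (laurent A)
  lwdw (coefmap_is_zmod_morphism euler_zmod_morphism).

Lemma lcoef_lwdw x : lwdw x = swdw x :> fseries A. Proof. by []. Qed.

Lemma lcoef_lwdwE x k : lwdw x k = k%:~R * x k. Proof. by []. Qed.

Lemma vanish_below_lwdw N (x : laurent A) :
  vanish_below N x -> vanish_below N (lwdw x).
Proof. exact: vanish_below_coefmap. Qed.

Lemma lwdwM (x y : laurent A) : lwdw (x * y) = lwdw x * y + x * lwdw y.
Proof.
by apply: coefmap_leibniz => i j a b; rewrite rmorphD /=; ring.
Qed.

Lemma lwdw_lmono c m : lwdw (lmono c m) = lmono (m%:~R * c) m :> laurent A.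
Proof.
apply/laurentP => k; rewrite lcoef_lwdwE !lmonoE.
by case: eqP => [->|]; rewrite ?mulr0.
Qed.

Lemma lwdw_lconst c : lwdw (lconst c) = 0 :> laurent A.
Proof.
by rewrite lwdw_lmono mul0r; apply/laurentP => k; rewrite lmonoE if_same.
Qed.

Lemma lwdw_lconstM c x : lwdw (lconst c * x) = lconst c * lwdw x.
Proof. by rewrite lwdwM lwdw_lconst mul0r add0r. Qed.
End EulerDerivation.

(** * Inverses, polynomials in a series, and Lagrange inversion *)

Lemma vanish_belowV (K : fieldType) (x : laurent K) N :
  vanish_below N x -> x N != 0 -> vanish_below (- N) x^-1.
Proof.
move=> x0 xN; have x_neq0 : x != 0.
  by apply: contra_neq xN => ->; rewrite lcoef0.
have [M y0 yM] : exists2 M, vanish_below M x^-1 & x^-1 M != 0.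
  by apply: laurent_lead; rewrite invr_eq0.
suff -> : - N = M by [].
have /eqP : (x * x^-1) (N + M) != 0 by rewrite (lcoefM_lead x0 y0) mulf_neq0.
by rewrite divff// lcoef1 /smono; case: eqP => // NM _; lia.
Qed.

Lemma vanish_belowXz (K : fieldType) (x : laurent K) k :
  vanish_below 1 x -> x 1 != 0 -> vanish_below k (x ^ k).
Proof.
move=> x0 x1; case: k => n.
  by have := vanish_belowX (n := n) x0; rewrite natz.
rewrite NegzE -exprnN -exprVn.
have := vanish_belowX (n := n.+1) (vanish_belowV x0 x1).
by rewrite mulNrn natz.
Qed.

Section PolyEval.
Variable A : comNzRingType.
Implicit Types (P Q : {poly A}) (g : laurent A).

Definition peval P g : laurent A := (map_poly (@lconst A) P).[g].

Lemma pevalE n P g : (size P <= n)%N ->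
  peval P g = \sum_(i < n) lconst P`_i * g ^+ i.
Proof.
move=> Pn; rewrite /peval (@horner_coef_wide _ n); last first.
  by apply: leq_trans Pn; exact: size_poly.
by apply: eq_bigr => i _; rewrite coef_map.
Qed.

Lemma pevalM P Q g : peval (P * Q) g = peval P g * peval Q g.
Proof. by rewrite /peval rmorphM hornerM. Qed.

Lemma pevalB P Q g : peval (P - Q) g = peval P g - peval Q g.
Proof. by rewrite /peval rmorphB hornerD hornerN. Qed.

Lemma pevalN P g : peval (- P) g = - peval P g.
Proof. by rewrite /peval rmorphN hornerN. Qed.

Lemma pevalD P Q g : peval (P + Q) g = peval P g + peval Q g.
Proof. by rewrite /peval rmorphD hornerD. Qed.

Lemma pevalC c g : peval c%:P g = lconst c.
Proof. by rewrite /peval map_polyC hornerC. Qed.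

Lemma pevalX g : peval 'X g = g.
Proof. by rewrite /peval map_polyX hornerX. Qed.

Lemma pevalXn P g n : peval (P ^+ n) g = peval P g ^+ n.
Proof. by rewrite /peval rmorphXn horner_exp. Qed.

Lemma lcoef_peval_lmono e P n :
  e != 0 -> peval P (lmono 1 e) (e *+ n) = P`_n.
Proof.
move=> e0; pose N := maxn (size P) n.+1; have nN : (n < N)%N by rewrite leq_maxr.
rewrite (@pevalE N) ?leq_maxl// lcoef_sum.
under eq_bigr => i _ do rewrite lmonoX lcoef_lconstM lmonoE.
rewrite (bigD1 (Ordinal nN))//= eqxx mulr1 big1 ?addr0// => i.
rewrite -val_eqE /= => ik; rewrite ifN ?mulr0//; apply: contra ik.
by rewrite (inj_eq (mulrIn e0)) eq_sym.
Qed.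

Lemma lcoef_peval_lmono0 e P k :
  (forall n, k != e *+ n) -> peval P (lmono 1 e) k = 0.
Proof.
move=> ke; rewrite (@pevalE (size P))// lcoef_sum big1// => i _.
by rewrite lmonoX lcoef_lconstM lmonoE ifN ?mulr0.
Qed.

Lemma lcoef_peval_w P k :
  peval P (lmono 1 1) k = if 0 <= k then P`_`|k|%N else 0.
Proof.
case: ifP => k0; last by apply: lcoef_peval_lmono0 => n; rewrite natz; lia.
by rewrite -(@lcoef_peval_lmono 1)//; congr (lcoef _ _); rewrite natz; lia.
Qed.

Lemma lcoef_peval_winv P k :
  peval P (lmono 1 (- 1)) k = if k <= 0 then P`_`|k|%N else 0.
Proof.
case: ifP => k0; last first.
  by apply: lcoef_peval_lmono0 => n; rewrite mulNrn natz; lia.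
rewrite -(@lcoef_peval_lmono (- 1))//; congr (lcoef _ _).
by rewrite mulNrn natz; lia.
Qed.

Lemma peval_w_inj P Q : peval P (lmono 1 1) = peval Q (lmono 1 1) -> P = Q.
Proof.
move=> PQ; apply/polyP => i.
by have := congr1 (fun x : laurent A => x i%:Z) PQ; rewrite !lcoef_peval_w.
Qed.
End PolyEval.

(** Replacing a base of an n-th power by one that agrees with it to high order
    loses one order of agreement per extra factor with a simple pole. *)
Lemma vanish_below_subXX (A : comNzRingType) (x y : laurent A) (M : int) n :
  vanish_below (- 1) x -> vanish_below (- 1) y -> vanish_below M (x - y) ->
  vanish_below (M + 1 - n%:Z) (x ^+ n - y ^+ n).
Proof.
move=> x0 y0 xyM; rewrite subrXX.
have -> : M + 1 - n%:Z = M + (1 - n%:Z) by rewrite addrA.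
apply: vanish_belowM => //; apply: vanish_below_sum => -[i /= ilt] _.
have := vanish_belowM (vanish_belowX (n := (n.-1 - i)%N) x0)
  (vanish_belowX (n := i) y0).
apply: vanish_belowW; rewrite !mulNrn !natz; lia.
Qed.

(** For nonzero [j] the series is [D (g ^ j) / j] with [D = w d/dw], and [D] kills
    the constant term; for [j = 0] the value is the order of [g], which is one. *)
Lemma residue_dlog (K : numFieldType) (g : laurent K) (j : int) :
  vanish_below 1 g -> g 1 != 0 ->
  (g ^ j * (lwdw g / g)) 0 = (j == 0)%:R.
Proof.
move=> g0 g1; have g_neq0 : g != 0 by apply: contra_neq g1 => ->; rewrite lcoef0.
have [->|j0] := eqVneq j 0.
  have := lcoefM_lead (vanish_below_lwdw g0) (vanish_belowV g0 g1).
  have := lcoefM_lead g0 (vanish_belowV g0 g1).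
  rewrite expr0z mul1r lcoef_lwdwE mul1r subrr => <- ->.
  by rewrite divff// lcoef1.
have := congr1 (fun x : laurent K => x 0) (derivationXz (@lwdwM K) j g_neq0).
rewrite lcoef_lwdwE mul0r -[j%:~R * _ * _]mulrA -[j%:~R](rmorph_int (@lconst K)).
rewrite lcoef_lconstM => /esym/eqP; rewrite mulf_eq0 intr_eq0 (negbTE j0) /=.
by move=> /eqP.
Qed.

(** The series at hand have at most a simple pole, so that multiplying by the
    variable is enough to make the truncations polynomials. *)
Definition ltrunc (K : comNzRingType) (n : nat) (a : laurent K) : {poly K} :=
  \poly_(i < n) a (i%:Z - 1).

Lemma ltrunc_approx (A : comNzRingType) (a : laurent A) n :
  vanish_below (- 1) a ->
  vanish_below n%:Z (lmono 1 1 * a - peval (ltrunc n a) (lmono 1 1)).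
Proof.
move=> a0 k kn; rewrite lcoefB lcoef_lmonoM lcoef_peval_w mul1r.
case: ifP => k0; last by rewrite a0 ?subr0//; lia.
rewrite coef_poly ifT; last by lia.
by rewrite (_ : `|k|%N%:Z = k) ?subrr//; lia.
Qed.

Lemma vanish_below_peval (K : comNzRingType) (P : {poly K}) (g : laurent K) n :
  (forall i, (i < n)%N -> P`_i = 0) -> vanish_below 1 g ->
  vanish_below n%:Z (peval P g).
Proof.
move=> P0 g0; rewrite (@pevalE _ (size P))//; apply: vanish_below_sum => i _.
have [/P0->|ni] := ltnP i n; first by rewrite rmorph0 mul0r => k _; exact: lcoef0.
apply: (@vanish_belowM _ 0 n%:Z); first exact: vanish_below_lmono.
by have := vanish_belowX (n := i) g0; apply: vanish_belowW; rewrite natz.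
Qed.

Section Composition.
Variables (K : fieldType) (g : laurent K).
Hypotheses (g0 : vanish_below 1 g) (g1 : g 1 != 0).

Let g_neq0 : g != 0.
Proof. by apply: contra_neq g1 => ->; rewrite lcoef0. Qed.

(** As [g] vanishes at zero, the high terms of [a] contribute only high terms to
    the composition of [a] with [g]; the division by [g] undoes the shift of
    [ltrunc]. *)
Lemma scomp_ltrunc (a : laurent K) (n : nat) k :
  vanish_below (- 1) a -> k < n%:Z - 1 ->
  \sum_(i \in [set: int]) a i * (g ^ i) k = (peval (ltrunc n a) g / g) k.
Proof.
move=> a0 kn; rewrite (@fsum_window _ _ (- 1) n); last first.
  move=> i [/a0->|ni]; rewrite ?mul0r// (@vanish_belowXz _ _ i)// ?mulr0//; lia.
rewrite (pevalE _ (size_poly _ _)) mulr_suml lcoef_sum.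
apply: eq_bigr => i _; rewrite coef_poly ltn_ord -mulrA lcoef_lconstM.
by rewrite [-1 + _]addrC expfzDr.
Qed.

Lemma vanish_below_peval_div (P : {poly K}) :
  vanish_below (- 1) (peval P g / g).
Proof.
apply: (@vanish_belowM _ 0 (- 1)); last exact: vanish_belowV.
exact: (@vanish_below_peval _ _ _ 0).
Qed.

(** Composition with [g] commutes with reciprocals because evaluation of
    polynomials at [g] is multiplicative: the truncations of [f] and [u], shifted
    by one, multiply to [w ^+ 2] up to high order. *)
Lemma scompV (f u : laurent K) :
  vanish_below (- 1) f -> vanish_below (- 1) u -> f * u = 1 ->
  (forall k, \sum_(i \in [set: int]) u i * (g ^ i) k = smono 1 1 k) ->
  forall k, \sum_(i \in [set: int]) f i * (g ^ i) k = smono 1 (- 1) k.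
Proof.
move=> f0 u0 fu ug k; pose n := `|k|%N.+4.
(* The three extra orders make up for the division by [g ^+ 2] and for the
   product with [y^-1]. *)
rewrite (@scomp_ltrunc _ n)//; last by rewrite /n; lia.
pose y : laurent K := lmono 1 1; pose y1 : laurent K := lmono 1 (- 1).
pose F := peval (ltrunc n f) g / g; pose U := peval (ltrunc n u) g / g.
have Uy : vanish_below (n%:Z - 1) (U - y).
  move=> i ni; rewrite lcoefB -(@scomp_ltrunc _ n)// ug.
  by rewrite [y i]lmonoE subrr.
have FU : vanish_below (n%:Z - 2) (F * U - 1).
  have -> : F * U - 1 = (peval (ltrunc n f * ltrunc n u - 'X^2) g) * g^-1 ^+ 2.
    by rewrite pevalB pevalM pevalXn pevalX /F /U; field.
  apply: (@vanish_belowM _ n%:Z (- 2)); last first.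
    by have := vanish_belowX (n := 2) (vanish_belowV g0 g1).
  apply: vanish_below_peval => // i ni.
  have yu0 : vanish_below 0 (y * u).
    by apply: (@vanish_belowM _ 1 (- 1)) => //; exact: vanish_below_lmono.
  have fy0 : vanish_below 0 (peval (ltrunc n f) y).
    by apply: vanish_below_peval => //; exact: vanish_below_lmono.
  have : vanish_below n%:Z (peval ('X^2 - ltrunc n f * ltrunc n u) y).
    have -> : peval ('X^2 - ltrunc n f * ltrunc n u) y
        = (y * f - peval (ltrunc n f) y) * (y * u)
          + peval (ltrunc n f) y * (y * u - peval (ltrunc n u) y).
      rewrite pevalB pevalXn pevalM pevalX -[y ^+ 2]mulr1 -fu; ring.
    apply: vanish_belowD.
      by have := vanish_belowM (ltrunc_approx (n := n) f0) yu0; rewrite addr0.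
    by have := vanish_belowM fy0 (ltrunc_approx (n := n) u0); rewrite add0r.
  move=> /(_ i%:Z); rewrite lcoef_peval_w /= coefB => /(_ ni) /eqP.
  by rewrite subr_eq0 coefB => /eqP ->; rewrite subrr.
have : vanish_below (n%:Z - 3) (F - y1).
  have -> : F - y1 = y1 * ((F * U - 1) - F * (U - y)).
    have yy : y1 * y = 1 by rewrite lmonoM mulr1 addNr.
    transitivity (F * (y1 * y) - y1); first by rewrite yy mulr1.
    ring.
  apply: (@vanish_belowM _ (- 1) (n%:Z - 2)); first exact: vanish_below_lmono.
  apply: vanish_belowB => //.
  apply: (@vanish_belowM _ (- 1) (n%:Z - 1)) => //; exact: vanish_below_peval_div.
move=> /(_ k) Fy; apply/eqP; rewrite -subr_eq0; apply/eqP; apply: Fy.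
rewrite /n; lia.
Qed.
End Composition.

(** Lagrange inversion in the form of Schur and Jabotinsky.  If [f] composed
    with [g] is the inverse of the variable [y], then the coefficients of
    [f ^+ n] expand [y ^- n] in powers of [g].  Applying the Euler derivation and
    pairing with [g ^+ m] isolates one coefficient on each side,
    because [g ^ j * (lwdw g / g)] has a constant term only for [j = 0].
    The infinite expansion is cut off where it no longer matters, so that only
    polynomials in [g] occur. *)
Lemma lagrange_inversion (K : numFieldType) (f g : laurent K) (n m : nat) :
  vanish_below (- 1) f -> vanish_below 1 g -> g 1 != 0 ->
  (forall k, \sum_(i \in [set: int]) f i * (g ^ i) k = smono 1 (- 1) k) ->
  (m <= n)%N ->
  n%:R * (g ^+ m) n%:Z = m%:R * (f ^+ n) (- m%:Z).
Proof.
move=> f0 g0 g1 fg mn.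
have g_neq0 : g != 0 by apply: contra_neq g1 => ->; rewrite lcoef0.
pose P := ltrunc n.+1 f.
pose Q : laurent K := peval P g / g; pose y1 : laurent K := lmono 1 (- 1).
have y10 : vanish_below (- 1) y1 by exact: vanish_below_lmono.
have Q0 : vanish_below (- 1) Q by exact: vanish_below_peval_div.
have Qy : vanish_below n%:Z (Q - y1).
  move=> k kn; rewrite lcoefB -(scomp_ltrunc g0 g1 f0) ?fg; last by lia.
  by rewrite [y1 k]lmonoE subrr.
have Qny : vanish_below 1 (Q ^+ n - y1 ^+ n).
  by have := vanish_below_subXX (n := n) Q0 y10 Qy; apply: vanish_belowW; lia.
pose N := maxn (size (P ^+ n)) n.+1.
have QnE : Q ^+ n = \sum_(i < N) lconst (P ^+ n)`_i * g ^ (i%:Z - n%:Z).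
  rewrite /Q expr_div_n -pevalXn (@pevalE _ N) ?leq_maxl// mulr_suml.
  by apply: eq_bigr => i _; rewrite -mulrA expfzDr// -exprnN.
have gm0 : vanish_below 0 (g ^+ m).
  by apply: (@vanish_belowW _ m%:Z) => //; exact: (vanish_belowXz (k := m)).
have /eqP : (g ^+ m * lwdw (Q ^+ n - y1 ^+ n)) 0 = 0.
  have := vanish_belowM gm0 (vanish_below_lwdw Qny); exact.
rewrite raddfB mulrBr lcoefB subr_eq0 => /eqP.
have -> : (g ^+ m * lwdw (y1 ^+ n)) 0 = - (n%:R * (g ^+ m) n%:Z).
  rewrite lmonoX lwdw_lmono mulrC lcoef_lmonoM mulr1 mulNrn natz sub0r opprK.
  by rewrite mulrNz mulNr.
have termE c (j : int) : (g ^+ m * lwdw (lconst c * g ^ j)) 0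
    = c * (j%:~R * (m%:Z + j == 0)%:R).
  rewrite lwdw_lconstM (derivationXz (@lwdwM K)) // mulrCA lcoef_lconstM.
  congr (_ * _); rewrite -(residue_dlog _ g0 g1) expfzDr// -exprnP.
  by rewrite -[j%:~R](rmorph_int (@lconst K)) -!mulrA mulrCA lcoef_lconstM.
have -> : (g ^+ m * lwdw (Q ^+ n)) 0 = - (m%:R * (P ^+ n)`_(n - m)).
  rewrite QnE raddf_sum mulr_sumr lcoef_sum.
  under eq_bigr => i _ do rewrite termE.
  have nmN : (n - m < N)%N by rewrite leq_max ltnS leq_subr orbT.
  rewrite (bigD1 (Ordinal nmN))//= big1 => [|i]; last first.
    rewrite -val_eqE /= => inm; rewrite (_ : _ == 0 = false) ?mulr0//.
    by apply: contraNF inm; lia.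
  rewrite (_ : _ == 0) ?mulr1 ?addr0; last by lia.
  by rewrite (_ : _ - _ = - m%:Z) ?mulrNz ?mulrN 1?mulrC//; lia.
move=> /(@oppr_inj K) e; rewrite -e; congr (_ * _).
pose F : laurent K := y1 * peval P (lmono 1 1).
have Ff : vanish_below n%:Z (f - F).
  have -> : f - F = y1 * (lmono 1 1 * f - peval P (lmono 1 1)).
    by rewrite mulrBr mulrA lmonoM mulr1 addNr mul1r.
  have := vanish_belowM y10 (ltrunc_approx (n := n.+1) f0).
  by apply: vanish_belowW; lia.
have F0 : vanish_below (- 1) F.
  apply: (@vanish_belowM _ (- 1) 0) => // k k0.
  by rewrite lcoef_peval_w ifN// -ltNge.
have mlt : - m%:Z < n%:Z + 1 - n%:Z by lia.
move: (vanish_below_subXX (n := n) f0 F0 Ff mlt) => /eqP.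
rewrite lcoefB subr_eq0 => /eqP ->.
rewrite exprMn -pevalXn lmonoX lcoef_lmonoM mul1r mulNrn natz lcoef_peval_w.
rewrite ifT; last by lia.
by congr (_`_ _); lia.
Qed.

(** * Series at infinity *)

Definition srefl {A : Type} (a : fseries A) : fseries A := fun k => a (- k).

Lemma sreflK (A : Type) : involutive (@srefl A).
Proof. by move=> a; apply/funext => k; rewrite /srefl opprK. Qed.

Lemma srefl_smul (A : nzRingType) (a b : fseries A) :
  srefl (a ** b) = srefl a ** srefl b.
Proof.
apply/funext => k; rewrite /srefl /smul (reindex_fsbigT (@GRing.opp int)).
  by apply: eq_fsbigr => i _; rewrite opprK opprB addrC.
by exists (@GRing.opp int); exact: opprK.
Qed.

Lemma srefl_smono (A : nzRingType) (c : A) m : srefl (smono c m) = smono c (- m).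
Proof. by apply/funext => k; rewrite /srefl /smono eqr_oppLR. Qed.

Lemma srefl_spow (A : nzRingType) (a : fseries A) n :
  srefl (spow a n) = spow (srefl a) n.
Proof.
elim: n => [|n IH]; first by rewrite /= srefl_smono oppr0.
by rewrite /= srefl_smul IH.
Qed.

Lemma laurent_zero_srefl (A : nzRingType) (a : fseries A) :
  laurent_inf a -> laurent_zero (srefl a).
Proof. by move=> [N a0]; exists (- N) => k kN; apply: a0; lia. Qed.

Lemma laurent_inf_srefl (A : nzRingType) (a : fseries A) :
  laurent_zero a -> laurent_inf (srefl a).
Proof. by move=> [N a0]; exists (- N) => k kN; apply: a0; lia. Qed.

Lemma srecip_inf_srefl (K : fieldType) (x : laurent K) :
  x != 0 -> srecip_inf (srefl x) = srefl x^-1.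
Proof.
move=> x0; apply: xget_unique => [|b [/laurent_zero_srefl bN xb]].
  split; first exact: laurent_inf_srefl (laurent_bounded _).
  by rewrite -srefl_smul -lcoefM divff// lcoef1 srefl_smono oppr0.
have xb1 : x * to_laurent bN = 1.
  apply: val_inj; rewrite /= -[LHS]sreflK; rewrite srefl_smul sreflK xb.
  by rewrite srefl_smono oppr0.
have -> : x^-1 = to_laurent bN by apply: (mulfI x0); rewrite xb1 divff.
by rewrite sreflK.
Qed.

Lemma spowz_inf_srefl (K : fieldType) (x : laurent K) k :
  x != 0 -> spowz_inf (srefl x) k = srefl (x ^ k).
Proof.
move=> x0; case: k => n; first by rewrite /= -srefl_spow -lcoefX.
by rewrite /spowz_inf srecip_inf_srefl// -srefl_spow -lcoefX exprVn.
Qed.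

(** * The logarithm and the Faber polynomials *)

Lemma lpoly_zmod_morphism (A : comNzRingType) (k : int) :
  zmod_morphism (@polyC A).
Proof. exact: polyCB. Qed.

Definition lpoly (A : comNzRingType) : laurent A -> laurent {poly A} :=
  coefmap (@lpoly_zmod_morphism A).

Lemma lpolyM (A : comNzRingType) (x y : laurent A) :
  lpoly (x * y) = lpoly x * lpoly y.
Proof.
apply/laurentP => k.
have [N x0] := laurent_bounded x; have [M y0] := laurent_bounded y.
pose n := `|(k - N - M)%R|%N.+1.
have kM i : N + n%:Z <= i -> k - i < M by rewrite /n; lia.
rewrite -[LHS]/(polyC ((x * y) k)) !lcoefM !(@smul_window _ _ _ k N n)//.
- by rewrite rmorph_sum; apply: eq_bigr => i _; rewrite rmorphM.
- exact: vanish_below_coefmap.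
- by move=> i /kM ik; exact: (vanish_below_coefmap (@lpoly_zmod_morphism A) y0).
- by move=> i /kM /y0.
Qed.

Lemma lpolyX (A : comNzRingType) (x : laurent A) n :
  lpoly (x ^+ n) = lpoly x ^+ n.
Proof.
elim: n => [|n IH]; last by rewrite !exprS lpolyM IH.
by apply/laurentP => k; rewrite /= /smono; case: ifP.
Qed.

Section LogDerivative.
Variable K : numFieldType.
Implicit Types (x y : laurent {poly K}).

Lemma slog_srefl (x : fseries {poly K}) k : slog (srefl x) k = slog x (- k).
Proof.
apply: eq_fsbigr => j _; congr (_ *: _).
rewrite (_ : (fun i => _) = srefl (fun i => x i - smono 1 0 i)).
  by rewrite -srefl_spow.
by apply/funext => i; rewrite /srefl /smono oppr_eq0.
Qed.

Lemma slogE y k n : vanish_below 1 y -> k <= n%:Z ->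
  slog (1 + y : laurent _) k
  = \sum_(j < n) ((-1) ^+ j / j.+1%:R) *: (y ^+ j.+1) k.
Proof.
move=> y0 kn; pose F (j : nat) : {poly K} :=
  ((-1) ^+ j / j.+1%:R) *: (y ^+ j.+1) k.
rewrite -[RHS]/(\sum_(j < n) F j) fsbig_ord.
rewrite /slog (_ : (fun i => _) = y); last first.
  by apply/funext => i; rewrite lcoefD lcoef1 addrAC subrr add0r.
apply/esym; rewrite (@fsbig_widen _ _ _ _ _ [set: nat])//.
  by apply: eq_fsbigr => j _; rewrite /F lcoefX.
move=> j [_ /= jn]; rewrite /F.
rewrite (vanish_belowX (n := j.+1) y0) ?scaler0//.
move: jn; rewrite natz; lia.
Qed.

Fact wderiv_zmod_morphism (k : int) : zmod_morphism (@deriv K).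
Proof. exact: derivB. Qed.

Definition wderiv : laurent {poly K} -> laurent {poly K} :=
  coefmap wderiv_zmod_morphism.

Lemma wderivM x y : wderiv (x * y) = wderiv x * y + x * wderiv y.
Proof. by apply: coefmap_leibniz => i j a b; exact: derivM. Qed.

(** The logarithmic derivative of [G * (1 - w q)] with respect to [w] is the
    geometric series [- q / (1 - w q)].  Both this series and the one that
    defines the logarithm are cut off after the order that is read off.  With
    [w] standing for the coefficient ['X], the function that generates the first
    Faber polynomials is of this form with [q] the reciprocal of the inverse
    function at infinity, the one for the second has [q] the inverse function at
    zero, and [q = 0] covers the term without [w]. *)
Lemma deriv_slog (G q : laurent K) (n : nat) :
  vanish_below 0 G -> G 0 = 1 -> vanish_below 1 q ->
  (slog (lpoly G * (1 - lconst 'X * lpoly q) : laurent _) n%:Z)^`()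
  = - \sum_(j < n) (q ^+ j.+1) n%:Z *: 'X^j.
Proof.
move=> G0 G1 q0; pose g := lpoly G; pose t := lconst 'X * lpoly q.
have [y yE] : exists y, y = g * (1 - t) - 1 by exists (g * (1 - t) - 1).
have g0 : vanish_below 0 g by exact: vanish_below_coefmap.
have lq0 : vanish_below 1 (lpoly q) by exact: vanish_below_coefmap.
have t0 : vanish_below 1 t.
  by apply: (@vanish_belowM _ 0 1) => //; exact: vanish_below_lmono.
have y0 : vanish_below 1 y.
  have -> : y = (g - 1) - g * t by rewrite yE; ring.
  apply: vanish_belowB; last exact: (@vanish_belowM _ 0 1).
  move=> k k1; rewrite lcoefB lcoef1 /smono.
  have [->|k0] := eqVneq k 0; first by rewrite /= G1 subrr.
  by rewrite g0 ?subrr//; lia.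
have -> : g * (1 - t) = 1 + y by rewrite yE [RHS]addrC subrK.
rewrite (slogE (n := n.+1) y0)//; last by rewrite lez_nat.
have dy : wderiv y = - (g * lpoly q).
  apply/laurentP => k.
  rewrite yE lcoefN -[LHS]/(((g * (1 - t) - 1) k)^`()) lcoefB mulrBr mulr1.
  rewrite mulrCA lcoefB lcoef_lconstM lcoef1 /smono.
  rewrite -lpolyM !derivB /= derivM derivX mul1r !derivC mulr0 addr0 sub0r.
  by case: ifP => _; rewrite ?derivC ?deriv0 subr0.
pose S := \sum_(j < n.+1) (- y) ^+ j; pose T := \sum_(j < n.+1) t ^+ j.
have -> : (\sum_(j < n.+1) ((-1) ^+ j / j.+1%:R) *: (y ^+ j.+1) n%:Z)^`()
          = (S * wderiv y) n%:Z.
  rewrite (big_morph _ (@derivD K) (deriv0 K)) mulr_suml lcoef_sum.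
  apply: eq_bigr => j _.
  rewrite derivZ -[((y ^+ j.+1) _)^`()]/(wderiv (y ^+ j.+1) n%:Z).
  rewrite (derivationX wderivM) -mulrA.
  rewrite -[j.+1%:R : laurent {poly K}](rmorph_nat (@lconst {poly K})).
  rewrite lcoef_lconstM mulr_natl -scalerMnr scalerMnl -[_ *+ j.+1]mulr_natr.
  rewrite divfK ?pnatr_eq0//.
  rewrite [(- y) ^+ j]exprNn -signr_odd -[in RHS]signr_odd.
  by case: (odd j); rewrite ?scaleN1r ?scale1r ?mulN1r ?mul1r ?mulNr.
have geom (z : laurent {poly K}) :
    (1 - z) * (\sum_(j < n.+1) z ^+ j) = 1 - z ^+ n.+1.
  by rewrite -opprB mulNr -subrX1 opprB.
have SE : S * (g * (1 - t)) = 1 - (- y) ^+ n.+1.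
  by rewrite mulrC (_ : g * _ = 1 - - y) ?geom// yE opprK [RHS]addrC subrK.
have S0 : vanish_below 0 S.
  apply: vanish_below_sum => j _; apply: (@vanish_belowW _ j%:Z) => //.
  by have := vanish_belowX (n := j) (vanish_belowN y0); rewrite natz.
have T0 : vanish_below 0 T.
  apply: vanish_below_sum => j _; apply: (@vanish_belowW _ j%:Z) => //.
  by have := vanish_belowX (n := j) t0; rewrite natz.
have -> : S * wderiv y
    = - (T * lpoly q) + ((- y) ^+ n.+1 * T - S * g * t ^+ n.+1) * lpoly q.
  have := congr1 (fun z => z * T) SE; rewrite -!mulrA geom dy => STE.
  transitivity (- (S * (g * (1 - t ^+ n.+1)) + S * g * t ^+ n.+1) * lpoly q).
    ring.
  rewrite STE; ring.
rewrite lcoefD [X in _ + X](_ : _ = 0) ?addr0; last first.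
  have yX : vanish_below n.+1%:Z ((- y) ^+ n.+1).
    by have := vanish_belowX (n := n.+1) (vanish_belowN y0); rewrite natz.
  have tX : vanish_below n.+1%:Z (t ^+ n.+1).
    by have := vanish_belowX (n := n.+1) t0; rewrite natz.
  apply: (@vanish_belowM _ n.+1%:Z 1) => //; last by lia.
  apply: vanish_belowB.
    by have := vanish_belowM yX T0; rewrite addr0.
  by have := vanish_belowM (vanish_belowM S0 g0) tX; rewrite !add0r.
rewrite lcoefN mulr_suml lcoef_sum; congr (- _).
have tE (j : nat) : (t ^+ j * lpoly q) n%:Z = (q ^+ j.+1) n%:Z *: 'X^j.
  rewrite exprMn -lpolyX -mulrA -lpolyM -exprSr -rmorphXn lcoef_lconstM /=.
  by rewrite mulrC mul_polyC.
under eq_bigr => j _ do rewrite tE.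
rewrite big_ord_recr /= (vanish_belowX (n := n.+1) q0) ?scale0r ?addr0//.
rewrite natz; lia.
Qed.
End LogDerivative.

(** The value at [s] of [w d/dw] applied to the polynomial part of the n-th power
    of [f (w^-1)]: the coefficient of [f ^+ n] at [- m] is that of [w ^+ m]. *)
Definition faber_euler (K : numFieldType) (f : laurent K) (n : nat) (s : K) :=
  \sum_(j < n) j.+1%:R * (f ^+ n) (- j.+1%:Z) * s ^+ j.+1.

Section Faber.
Variable K : numFieldType.

Lemma faber_euler_lagrange (f g : laurent K) (n : nat) (s : K) :
  vanish_below (- 1) f -> vanish_below 1 g -> g 1 != 0 ->
  (forall k, \sum_(i \in [set: int]) f i * (g ^ i) k = smono 1 (- 1) k) ->
  s * (n%:R *: \sum_(j < n) (g ^+ j.+1) n%:Z *: 'X^j).[s] = faber_euler f n s.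
Proof.
move=> f0 g0 g1 fg; rewrite hornerZ horner_sum !mulr_sumr; apply: eq_bigr => j _.
rewrite -(lagrange_inversion f0 g0 g1 fg)// hornerZ hornerXn [s ^+ j.+1]exprS.
ring.
Qed.

Lemma deriv_faber_Phi (r : K) (p : fseries K) (g : laurent K) n :
  p = srefl g^-1 -> vanish_below 1 g -> g 1 = r -> r != 0 ->
  (faber_Phi r p n)^`() = n%:R *: \sum_(j < n) (g ^+ j.+1) n%:Z *: 'X^j.
Proof.
move=> -> g0 gr r0; have g_neq0 : g != 0.
  by apply: contra_neq r0 => g00; rewrite -gr g00 lcoef0.
pose G : laurent K := lmono r 1 * g^-1.
have gV0 : vanish_below (- 1) g^-1 by apply: vanish_belowV; rewrite ?gr.
have G0 : vanish_below 0 G.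
  by apply: (@vanish_belowM _ 1 (- 1)) => //; exact: vanish_below_lmono.
have G1 : G 0 = 1.
  have := lcoefM_lead (@vanish_below_lmono K r 1) gV0.
  have := lcoefM_lead g0 gV0; rewrite addrN -/G => + ->.
  by rewrite lmonoE eqxx divff// lcoef1 /smono eqxx gr => <-.
rewrite /faber_Phi derivZ.
rewrite (_ : (fun k => _) =
    srefl (lpoly G * (1 - lconst 'X * lpoly g) : laurent {poly K})).
  by rewrite slog_srefl opprK deriv_slog// scalerN scaleNr opprK.
have GgE : G * g = lmono r 1 by rewrite -mulrA mulVf// mulr1.
apply/funext => k; rewrite /srefl mulrBr mulr1 mulrCA -lpolyM GgE lcoefB.
rewrite lcoef_lconstM /= smul_smono /smono opprD scalerBr -!mul_polyC -polyCM.
congr (_ - _); have -> : (- k == 1) = (k + 1 == 0) by lia.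
by case: ifP; rewrite ?mulr0// mulrC.
Qed.

Lemma deriv_faber_Psi (r : K) (g : laurent K) n :
  vanish_below 1 g -> g 1 = r -> r != 0 ->
  (faber_Psi r g n)^`() = n%:R *: \sum_(j < n) (g ^+ j.+1) n%:Z *: 'X^j.
Proof.
move=> g0 gr r0; rewrite /faber_Psi derivZ derivB.
rewrite (_ : (fun k => smono 1 0 k - g k *: 'X) =
    (lpoly 1 * (1 - lconst 'X * lpoly g) : laurent {poly K})); last first.
  apply/funext => k; rewrite mulrBr mulr1 mulrCA -lpolyM mul1r lcoefB.
  rewrite lcoef_lconstM /= /smono [X in _ = _ - X]mulrC mul_polyC.
  by case: ifP.
pose G : laurent K := lmono r^-1 (- 1) * g.
have G0 : vanish_below 0 G.
  by apply: (@vanish_belowM _ (- 1) 1) => //; exact: vanish_below_lmono.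
have G1 : G 0 = 1.
  by rewrite lcoef_lmonoM gr mulVf.
rewrite (_ : (fun k => (r^-1 * g (k + 1))%:P) =
    (lpoly G * (1 - lconst 'X * lpoly 0) : laurent {poly K})); last first.
  apply/funext => k; rewrite (_ : lpoly 0 = 0); last by apply/laurentP.
  by rewrite mulr0 subr0 mulr1 /= smul_smono opprK.
rewrite !deriv_slog//; last first.
- exact: vanish_below_lmono.
rewrite [X in _ - X](_ : _ = 0) ?subr0 ?scalerN ?scaleNr ?opprK//.
by rewrite big1 ?oppr0// => j _; rewrite exprS mul0r scale0r.
Qed.

(** In the variable [z^-1] the inverse function at infinity has a simple pole;
    its reciprocal [g] is the series to which Lagrange inversion applies. *)
Lemma is_inverse_inf_euler (r : K) (f : laurent K) (p : fseries K) n s :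
  vanish_below (- 1) f -> r != 0 -> is_inverse_inf r (srefl f) p ->
  s * ((faber_Phi r p n)^`()).[s] = faber_euler f n s.
Proof.
move=> f0 r0 [p1 p_gt1 fp _].
have x0 : vanish_below (- 1) (srefl p) by move=> k k1; apply: p_gt1; lia.
have xN : exists N, vanish_below N (srefl p) by exists (- 1).
pose x : laurent K := to_laurent xN; have {}x0 : vanish_below (- 1) x by [].
have x1 : x (- 1) = r^-1 by rewrite -p1 /= /srefl opprK.
have x1_neq0 : x (- 1) != 0 by rewrite x1 invr_eq0.
have x_neq0 : x != 0 by apply: contra_neq x1_neq0 => ->; rewrite lcoef0.
pose g := x^-1; have g0 : vanish_below 1 g by exact: (vanish_belowV x0).
have gr : g 1 = r.
  have := lcoefM_lead (x := x) x0 g0; rewrite divff// x1 lcoef1 /smono /=.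
  by move=> /esym /(canRL (mulKf _)); rewrite invr_eq0 mulr1 invrK; apply.
have g1 : g 1 != 0 by rewrite gr.
have pE : p = srefl g^-1 by rewrite invrK /= sreflK.
rewrite (deriv_faber_Phi _ pE)//; apply: faber_euler_lagrange => // k.
have /(congr1 (fun a : fseries K => a (- k))) := fp; rewrite /scomp_inf.
rewrite (reindex_fsbigT (@GRing.opp int)); last first.
  by exists (@GRing.opp int); exact: opprK.
have -> : smono 1 1 (- k) = smono 1 (- 1) k :> K.
  by rewrite /smono eqr_oppLR.
move=> <-; apply: eq_fsbigr => i _; rewrite /srefl opprK; congr (_ * _).
rewrite -[p]sreflK -[srefl p]/(x : fseries K) spowz_inf_srefl// /srefl opprK.
by rewrite /g -exprz_inv.
Qed.

(** The hypothesis composes the reciprocal of [h] with the inverse function, and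
    Lagrange inversion needs the composition of [h] itself: hence [scompV]. *)
Lemma is_inverse_zero_euler (r : K) (h : laurent K) (pt : fseries K) n s :
  vanish_below (- 1) h -> h (- 1) = r -> r != 0 ->
  is_inverse_zero r (srecip_zero h) pt ->
  s * ((faber_Psi r pt n)^`()).[s] = faber_euler h n s.
Proof.
move=> h0 hr r0 [pt1 pt_lt1 hpt _].
have gN : exists N, vanish_below N pt by exists 1.
pose g : laurent K := to_laurent gN; have g0 : vanish_below 1 g by [].
have g1 : g 1 != 0 by rewrite /= pt1.
have h1 : h (- 1) != 0 by rewrite hr.
have h_neq0 : h != 0 by apply: contra_neq h1 => ->; rewrite lcoef0.
rewrite -[pt]/(g : fseries K) deriv_faber_Psi//; apply: faber_euler_lagrange => //.
apply: (@scompV _ _ _ _ _ h^-1) => //.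
- by apply: (@vanish_belowW _ 1) => //; exact: (vanish_belowV h0).
- by rewrite divff.
move=> k; have /(congr1 (fun a : fseries K => a k)) := hpt.
rewrite /scomp_zero => <-.
by apply: eq_fsbigr => i _; rewrite spowz_zeroE lcoefV.
Qed.

Lemma xiE (r : K) (f h : laurent K) (p pt : fseries K) (s : K) :
  vanish_below (- 1) f -> vanish_below (- 1) h -> h (- 1) = r ->
  r != 0 -> s != 0 ->
  is_inverse_inf r (srefl f) p -> is_inverse_zero r (srecip_zero h) pt ->
  forall n, xi r p pt s n = match n with
    | Posz 0 => 1
    | Posz n => faber_euler f n s
    | Negz n => - faber_euler h n.+1 s^-1
    end.
Proof.
move=> f0 h0 hr r0 s0 fp hpt [[|n]|n] //=.
  exact: is_inverse_inf_euler.
rewrite -(is_inverse_zero_euler _ _ h0 hr r0 hpt) mulrA mulrN mulNr.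
congr (- (_ * _)).
by rewrite expr2 invfM mulVKf.
Qed.
End Faber.

(** * One-variable reductions *)

Lemma kernel_factor_neq0 (K : numFieldType) (s : K) m :
  m != 0 -> lconst s - lmono 1 m != 0.
Proof.
move=> m0; apply/eqP => /(congr1 (fun x : laurent K => x m)) /eqP.
by rewrite lcoefB !lmonoE eqxx (negbTE m0) sub0r oppr_eq0 oner_eq0.
Qed.

Section Reduction.
Variable K : numFieldType.
Implicit Types (f h df dh : laurent K) (P X : {poly K}).

Let w : laurent K := lmono 1 1.
Let w1 : laurent K := lmono 1 (- 1).

(** The Lax equations of one time for the series [f] in the variable [w^-1] and
    [h] in the variable [w].  Here [df] and [dh] stand for the
    [lambda]-derivatives, [a] and [a0] for the derivatives of [lambda] along that
    time and along [t_0], [P] for the Hamiltonian and [X] for its derivative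
    along [t_0]; since a polynomial in [w] is one in the inverse of the variable
    of [f], both are evaluated at [w1] in the first equation, whose last sign
    changes because [w d/dw] does.  Exchanging the two series and the signs of
    [a0] and [X] gives the equations of a negative time. *)
Definition reduced_flow f df h dh (a a0 : K) P X : Prop :=
  lconst a * df = lconst a0 * peval ('X * P^`()) w1 * df + peval X w1 * lwdw f /\
  lconst a * dh = lconst a0 * peval ('X * P^`()) w * dh - peval X w * lwdw h.

Lemma vanish_below_size_peval_winv X :
  vanish_below (- (size X).-1%:Z) (peval X w1).
Proof.
move=> k kX; rewrite lcoef_peval_winv; case: ifP => // k0.
apply: nth_default; move: kX; case: (size X) => [|m] /=; lia.
Qed.

Variables (f df h dh : laurent K) (r dr : K).
Hypotheses (f0 : vanish_below (- 1) f) (df0 : vanish_below (- 1) df).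
Hypotheses (h0 : vanish_below (- 1) h) (dh0 : vanish_below (- 1) dh).
Hypotheses (fr : f (- 1) = r) (hr : h (- 1) = r).
Hypotheses (dfr : df (- 1) = dr) (dhr : dh (- 1) = dr).
Hypothesis r0 : r != 0.
Hypothesis moving : ~ (df = 0 /\ dh = 0).

Let Df0 : vanish_below (- 1) (lwdw f). Proof. exact: vanish_below_lwdw. Qed.
Let Dh0 : vanish_below (- 1) (lwdw h). Proof. exact: vanish_below_lwdw. Qed.
Let Dfr : lwdw f (- 1) = - r. Proof. by rewrite lcoef_lwdwE fr mulN1r. Qed.
Let Dhr : lwdw h (- 1) = - r. Proof. by rewrite lcoef_lwdwE hr mulN1r. Qed.

(** Where [lambda] is stationary in [t_0], the second terms alone drive the
    flow.  Comparing degrees at infinity, the polynomial [X] is a constant; it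
    then scales the two leading coefficients, which agree, in opposite ways. *)
Lemma reduced_flow_stationary a P X :
  reduced_flow f df h dh a 0 P X -> a = 0.
Proof.
rewrite /reduced_flow rmorph0 !mul0r add0r sub0r => -[Ef Eh].
have sX : (size X <= 1)%N.
  rewrite leqNgt; apply/negP => X1; have X_neq0 : X != 0.
    by rewrite -size_poly_gt0; apply: leq_trans X1.
  have := lcoefM_lead (@vanish_below_size_peval_winv X) Df0.
  rewrite -Ef lcoef_lconstM df0; last by lia.
  rewrite Dfr lcoef_peval_winv ifT; last by lia.
  rewrite abszN absz_nat mulr0 => /esym/eqP.
  rewrite mulf_eq0 oppr_eq0 (negbTE r0) orbF -/(lead_coef X) lead_coef_eq0.
  by rewrite (negbTE X_neq0).
move: Ef Eh; rewrite (size1_polyC sX) !pevalC -mulNr -rmorphN.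
set c := X`_0 => Ef Eh.
have := congr1 (fun x : laurent K => x (- 1)) Ef.
have := congr1 (fun x : laurent K => x (- 1)) Eh.
rewrite !lcoef_lconstM dfr dhr Dfr Dhr => -> /eqP.
rewrite mulrNN mulrN -addr_eq0 -mulr2n mulrn_eq0 mulf_eq0 (negbTE r0) orbF /=.
move=> /eqP c0; move: Ef Eh; rewrite c0 ?oppr0 !rmorph0 !mul0r => /eqP + /eqP.
have [//|a_neq0] := eqVneq a 0.
rewrite !mulf_eq0 fmorph_eq0 (negbTE a_neq0) /= => /eqP df00 /eqP dh00.
by have := moving (conj df00 dh00).
Qed.

(** The radial Loewner equations, cleared of denominators. *)
Definition loewner_pair (s phi : K) : Prop :=
  (lconst s - w1) * df = lconst phi * (w1 + lconst s) * lwdw f /\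
  (lconst s - w) * dh = - (lconst phi * (w + lconst s) * lwdw h).

(** For the first time the Hamiltonian is [r w + c].  The coefficients of [w ^+ 2]
    at infinity and of [w] at zero determine [X], and the coefficient of [w] at
    infinity then expresses [a / (a0 r)] through the derivative of the second
    coefficient of [f].  If [dr] or this quotient vanished, then so would the
    [lambda]-derivatives of both series, or [dr] would equal [- dr]. *)
Lemma reduced_flow1 a a0 c X :
  a0 != 0 -> (size X <= 2)%N ->
  reduced_flow f df h dh a a0 (r *: 'X + c%:P) X ->
  [/\ dr != 0, df 0 / (dr *+ 2) != 0
    & loewner_pair (df 0 / (dr *+ 2)) (dr / r)].
Proof.
move=> a0_neq0 sX [].
have -> : 'X * (r *: 'X + c%:P)^`() = r%:P * 'X :> {poly K}.
  by rewrite derivD derivZ derivX derivC addr0 alg_polyC mulrC.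
have XE : X = (X`_1)%:P * 'X + (X`_0)%:P.
  apply/polyP => i; rewrite coefD coefCM coefX coefC.
  case: i => [|[|i]]; rewrite ?mulr0 ?add0r ?mulr1 ?addr0//.
  by rewrite nth_default//; exact: leq_trans sX _.
rewrite XE; set x1 := X`_1; set x0 := X`_0.
rewrite !(pevalD, pevalM, pevalC, pevalX) => Ef Eh.
have w1M (x : laurent K) k : (w1 * x) k = x (k + 1).
  by rewrite lcoef_lmonoM mul1r opprK.
have wM (x : laurent K) k : (w * x) k = x (k - 1).
  by rewrite lcoef_lmonoM mul1r.
have Ec k : a * df k
    = a0 * r * df (k + 1) + x1 * lwdw f (k + 1) + x0 * lwdw f k.
  have := congr1 (fun x : laurent K => x k) Ef.
  rewrite mulrDl -!mulrA [RHS]lcoefD [X in _ = _ + X]lcoefD 5!lcoef_lconstM.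
  by rewrite 2!w1M addrA mulrA.
have Hc k : a * dh k
    = a0 * r * dh (k - 1) - (x1 * lwdw h (k - 1) + x0 * lwdw h k).
  have := congr1 (fun x : laurent K => x k) Eh.
  rewrite mulrDl -!mulrA [RHS]lcoefB [X in _ = _ - X]lcoefD 5!lcoef_lconstM.
  by rewrite 2!wM mulrA.
have x1E : x1 = a0 * dr.
  have := Ec (- 2).
  rewrite (_ : -2 + 1 = -1 :> int)// dfr Dfr df0// Df0// !mulr0 addr0 => e.
  apply: (mulIf r0); rewrite mulrAC; apply/eqP.
  by rewrite -subr_eq0 -oppr_eq0 opprB -mulrN -e.
have x0E : x0 * r = a * dr.
  have := Hc (- 1).
  by rewrite dhr Dhr dh0// Dh0// !mulr0 !add0r mulrN opprK.
have E0 : a0 * r * df 0 = a * dr *+ 2.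
  have := Ec (- 1).
  rewrite (_ : -1 + 1 = 0 :> int)// lcoef_lwdwE mul0r mulr0 addr0.
  by rewrite dfr Dfr mulrN x0E mulr2n => {1}->; rewrite subrK.
have ar0 : a0 * r != 0 by rewrite mulf_neq0.
pose s := a / (a0 * r); pose phi := dr / r.
have LP : loewner_pair s phi.
  have aE : lconst a = lconst (a0 * r) * lconst s.
    by rewrite -rmorphM /s mulrC divfK.
  have x1F : lconst x1 = lconst (a0 * r) * lconst phi.
    by rewrite -rmorphM x1E /phi mulrACA divff// mulr1.
  have x0F : lconst x0 = lconst (a0 * r) * lconst s * lconst phi.
    rewrite -!rmorphM /s [a0 * r * _]mulrC divfK// /phi mulrA -x0E mulfK//.
  have C0 : lconst (a0 * r) != 0 by rewrite fmorph_eq0.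
  have CE : lconst (a0 * r) = lconst a0 * lconst r by rewrite rmorphM.
  move: Ef Eh; rewrite aE x1F x0F [lconst a0 * (_ * w1)]mulrA
    [lconst a0 * (_ * w)]mulrA -CE.
  set C := lconst (a0 * r) in C0 *; set S := lconst s; set F := lconst phi.
  move=> Ef Eh; split; apply: (mulfI C0).
    transitivity (C * S * df - C * w1 * df); first by ring.
    rewrite Ef; ring.
  transitivity (C * S * dh - C * w * dh); first by ring.
  rewrite Eh; ring.
have [Lf Lh] := LP.
have dr0 : dr != 0.
  apply/eqP => dr0; apply: moving.
  move: Lf Lh; rewrite /phi dr0 mul0r rmorph0 !mul0r oppr0 => /eqP + /eqP.
  by rewrite !mulf_eq0 !(negbTE (kernel_factor_neq0 _ _))//= => /eqP -> /eqP ->.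
have sE : df 0 / (dr *+ 2) = s.
  have dr20 : dr *+ 2 != 0 by rewrite mulrn_eq0.
  by apply/eqP; rewrite eqr_div// [df 0 * _]mulrC E0 mulrnAr.
rewrite sE; split=> //; apply/eqP => s0.
have := congr1 (fun x : laurent K => x 0) Lh.
rewrite s0 rmorph0 sub0r addr0 mulNr !lcoefN -mulrA lcoef_lconstM !wM.
rewrite sub0r dhr Dhr mulrN divfK// opprK => /eqP.
by rewrite eq_sym -addr_eq0 -mulr2n mulrn_eq0 (negbTE dr0).
Qed.

(** After substitution of the Loewner equation the factor [lwdw h] cancels, and an
    identity of polynomials remains, in which [X] is multiplied by [s - w]. *)
Lemma reduced_flow_speed a a0 s phi P X :
  s != 0 -> phi != 0 ->
  (lconst s - w) * dh = - (lconst phi * (w + lconst s) * lwdw h) ->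
  lconst a * dh = lconst a0 * peval ('X * P^`()) w * dh - peval X w * lwdw h ->
  a = a0 * (s * P^`().[s]).
Proof.
move=> s0 phi0 Lh Eh; have Dh_neq0 : lwdw h != 0.
  by apply: contra_neq r0 => Dh00; apply/oppr_inj; rewrite oppr0 -Dhr Dh00 lcoef0.
have [B BE] : exists B, B = 'X * P^`() by exists ('X * P^`()).
have E : peval ((a%:P - a0%:P * B) * (phi%:P * ('X + s%:P))) w
       = peval (X * (s%:P - 'X)) w.
  rewrite !(pevalM, pevalB, pevalD, pevalC, pevalX); apply: (mulIf Dh_neq0).
  move: Lh Eh; rewrite -BE; set A := lconst a; set S := lconst s.
  set A0 := lconst a0; set F := lconst phi; set Bw := peval B w.
  set Xw := peval X w; set D := lwdw h => Lh Eh.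
  transitivity (- (A - A0 * Bw) * (- (F * (w + S) * D))); first by ring.
  rewrite -Lh; transitivity ((S - w) * (A0 * Bw * dh - A * dh)); first by ring.
  rewrite Eh; ring.
have /(congr1 (fun Q : {poly K} => Q.[s])) := peval_w_inj E.
rewrite !hornerE subrr mulr0 => /eqP; rewrite !mulf_eq0 (negbTE phi0) /=.
rewrite -mulr2n mulrn_eq0 (negbTE s0) !orbF subr_eq0 => /eqP ->.
by rewrite BE !hornerE.
Qed.
End Reduction.

(** * Differentiation along a time *)

Section Derivatives.
Variable K : numFieldType.

(** The chain rule over any field with a norm, the complex numbers included. *)
Lemma derive1_comp_numField (f g : K -> K) x :
  derivable f x 1 -> derivable g (f x) 1 ->
  derive1 (g \o f) x = derive1 g (f x) * derive1 f x.
Proof.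
move=> /derivable1_diffP df /derivable1_diffP dg.
rewrite derive1E'; last exact/differentiable_comp.
rewrite diff_comp// !derive1E'//= -[X in 'd  _ _ X = _]mulr1.
by rewrite [LHS]linearZ mulrC.
Qed.

Lemma near_eq_derive1 (f g : K -> K) x :
  (\forall y \near x, f y = g y) -> derive1 f x = derive1 g x.
Proof. by move=> fg; rewrite !derive1E; exact: near_eq_derive. Qed.

Lemma slambda_deriv_vanish (a : K -> fseries K) (l : K) N :
  (\forall x \near l, vanish_below N (a x)) -> vanish_below N (slambda_deriv a l).
Proof.
move=> a0 k kN; rewrite /slambda_deriv (@near_eq_derive1 _ (cst 0)).
  exact: derive1_cst.
by apply: filterS a0 => x; exact.
Qed.

Lemma is_derive_smul (a b : K -> fseries K) (l : K) N M k :
  (\forall x \near l, vanish_below N (a x)) ->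
  (\forall x \near l, vanish_below M (b x)) ->
  (forall i, derivable (fun x => a x i) l 1) ->
  (forall i, derivable (fun x => b x i) l 1) ->
  is_derive l 1 (fun x => (a x ** b x) k)
    ((slambda_deriv a l ** b l) k + (a l ** slambda_deriv b l) k).
Proof.
move=> a0 b0 da db; pose n := `|(k - N - M)%R|%N.+1.
have kM i : N + n%:Z <= i -> k - i < M by rewrite /n; lia.
pose F (i : 'I_n) (x : K) : K := a x (N + i%:Z) * b x (k - (N + i%:Z)).
apply: (@near_eq_is_derive _ _ _ (\sum_(i < n) F i)).
  near=> x; have ax0 : vanish_below N (a x) by near: x.
  have bx0 : vanish_below M (b x) by near: x.
  rewrite fct_sumE (@smul_window _ _ _ k N n)// => i /kM; exact: bx0.
rewrite (@smul_window _ _ _ k N n); first last.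
- by move=> i /kM; exact: (nbhs_singleton b0).
- exact: slambda_deriv_vanish.
rewrite (@smul_window _ (a l) _ k N n); first last.
- by move=> i /kM; exact: (slambda_deriv_vanish b0).
- exact: (nbhs_singleton a0).
rewrite -big_split; apply: is_derive_sum => i.
apply: is_derive_eq.
  exact: (is_deriveM (derivableP (da _)) (derivableP (db (k - (N + i%:Z))))).
by rewrite /slambda_deriv !derive1E [RHS]addrC [X in _ + X = _]mulrC.
Unshelve. all: by end_near. Qed.
End Derivatives.

(** * The two series and their derivatives *)

Section TodaSeries.
Variable K : numFieldType.

Lemma toda_Ltinv_vanish (r : K) (v : nat -> K) :
  vanish_below (- 1) (toda_Ltinv r v).
Proof.
by move=> k k1; rewrite /toda_Ltinv lt_eqF// ifN// -ltNge (lt_trans k1).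
Qed.

Lemma toda_Ltinv_bounded (r : K) (v : nat -> K) : laurent_zero (toda_Ltinv r v).
Proof. by exists (- 1); exact: toda_Ltinv_vanish. Qed.

(** By [toda_L_srefl] below this is also the shape of the series at infinity, in
    the variable [w^-1]. *)
Definition ltoda (r : K) (v : nat -> K) : laurent K :=
  to_laurent (toda_Ltinv_bounded r v).

Lemma ltodaN1 r v : ltoda r v (- 1) = r. Proof. by []. Qed.

Lemma ltoda_nat r v n : ltoda r v n%:Z = v n. Proof. by []. Qed.

Lemma toda_L_srefl (r : K) (u : nat -> K) : toda_L r u = srefl (ltoda r u).
Proof.
apply/funext => k.
by rewrite /srefl /= /toda_Ltinv /toda_L eqr_opp oppr_ge0 abszN.
Qed.

Lemma ltoda_eq0 r v : ltoda r v = 0 <-> r = 0 /\ forall k, v k = 0.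
Proof.
split=> [rv0|[r0 v0]].
  by split=> [|k]; [rewrite -(ltodaN1 r v)|rewrite -(ltoda_nat r v)]; rewrite rv0.
apply/laurentP => k; rewrite /= /toda_Ltinv r0 v0; by do !case: ifP.
Qed.

Lemma ltoda_neq0 r v : r != 0 -> ltoda r v != 0.
Proof. by apply: contra_neq => /ltoda_eq0[]. Qed.

Lemma toda_Lt_vanish (r : K) (v : nat -> K) :
  r != 0 -> vanish_below 1 (toda_Lt r v).
Proof.
move=> r0.
exact: (@vanish_belowV _ (ltoda r v) (- 1) (toda_Ltinv_vanish _ _)).
Qed.

(** The recursion for the coefficients of a reciprocal: they are polynomials in
    the [v i] and [r^-1], hence differentiable. *)
Lemma toda_Lt_rec (r : K) (v : nat -> K) (n : nat) : r != 0 ->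
  toda_Lt r v n.+1%:Z =
  r^-1 * ((n == 0)%:R - \sum_(i < n) v i * toda_Lt r v (n%:Z - i%:Z)).
Proof.
move=> r0; apply: (mulfI r0); rewrite mulVKf//; apply/eqP.
rewrite eq_sym subr_eq eq_sym; apply/eqP.
have /(congr1 (fun x : laurent K => x n%:Z)) := divff (ltoda_neq0 v r0).
rewrite lcoef1 lcoefM (@smul_window _ _ _ _ (- 1) n.+1); first last.
- by move=> i ni; apply: (toda_Lt_vanish v r0); lia.
- exact: toda_Ltinv_vanish.
have -> : smono 1 0 n%:Z = (n == 0)%:R :> K by case: n.
rewrite big_ord_recl /= => <-; congr (_ * _ + _).
  by congr (toda_Lt _ _ _); lia.
apply: eq_bigr => i _; rewrite /bump /= add1n.
by rewrite (_ : -1 + i.+1%:Z = i%:Z); last lia.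
Qed.

Variables (r : K -> K) (v : nat -> K -> K) (l : K).
Hypothesis r_near : \forall x \near l, r x != 0.
Hypothesis dr : derivable r l 1.
Hypothesis dv : forall k, derivable (v k) l 1.

Lemma derivable_toda_Ltinv k :
  derivable (fun x => toda_Ltinv (r x) (v ^~ x) k) l 1.
Proof.
rewrite /toda_Ltinv; case: (k == -1) => //; case: (0 <= k); first exact: dv.
exact: derivable_cst.
Qed.

Lemma slambda_deriv_toda_Ltinv :
  slambda_deriv (fun x => toda_Ltinv (r x) (v ^~ x)) l
  = ltoda (derive1 r l) (fun k => derive1 (v k) l).
Proof.
apply/funext => k; rewrite /slambda_deriv /= /toda_Ltinv; case: (k == -1) => //.
by case: (0 <= k) => //; exact: derive1_cst.
Qed.

Lemma derivable_toda_Lt k : derivable (fun x => toda_Lt (r x) (v ^~ x) k) l 1.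
Proof.
have low i : i < 1 -> derivable (fun x => toda_Lt (r x) (v ^~ x) i) l 1.
  move=> i1; apply: (@near_eq_derivable _ _ _ (cst 0)); last exact: derivable_cst.
  by apply: filterS r_near => x rx; rewrite (toda_Lt_vanish _ rx).
have [/low//|k1] := ltP k 1; have -> : k = `|k|%N.-1.+1%:Z by lia.
elim/ltn_ind: {k k1}(`|k|%N.-1) => n IH.
pose F (i : 'I_n) (x : K) : K := v i x * toda_Lt (r x) (v ^~ x) (n%:Z - i%:Z).
apply: (@near_eq_derivable _ _ _
  ((fun x => (r x)^-1) * (cst (n == 0)%:R - \sum_(i < n) F i))).
  apply: filterS r_near => x rx; rewrite toda_Lt_rec//.
  rewrite -[LHS]/((r x)^-1 * ((n == 0)%:R - (\sum_(i < n) F i) x)).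
  by rewrite fct_sumE.
apply: derivableM.
  by apply: derivableV => //; exact: (nbhs_singleton r_near).
apply: derivableB; first exact: derivable_cst.
apply: derivable_sum => i; apply: derivableM; first exact: dv.
have [|n_gt] := ltnP i.+1 n.+1; last by have := ltn_ord i; lia.
move=> ilt; have -> : n%:Z - i%:Z = (n - i.+1).+1%:Z by lia.
by apply: IH; lia.
Qed.

Lemma slambda_deriv_toda_Lt :
  slambda_deriv (fun x => toda_Lt (r x) (v ^~ x)) l
  = - (ltoda (derive1 r l) (fun k => derive1 (v k) l)
       / ltoda (r l) (v ^~ l) ^+ 2) :> fseries K.
Proof.
have rl : r l != 0 := nbhs_singleton r_near.
pose h := ltoda (r l) (v ^~ l); have h_neq0 : h != 0 by exact: ltoda_neq0.
set dh := ltoda (derive1 r l) _.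
have Lt_near : \forall x \near l, vanish_below 1 (toda_Lt (r x) (v ^~ x)).
  by apply: filterS r_near => x rx; exact: toda_Lt_vanish.
have duB : laurent_zero (slambda_deriv (fun x => toda_Lt (r x) (v ^~ x)) l).
  by exists 1; exact: slambda_deriv_vanish.
pose du := to_laurent duB; suff -> : - (dh / h ^+ 2) = du by [].
suff : dh * h^-1 + h * du = 0 :> laurent K.
  move=> /(canRL (addKr _)); rewrite addr0 => e; apply: (mulfI h_neq0).
  by rewrite e expr2 invfM; field; exact: h_neq0.
apply/laurentP => k; have Ltinv_near : \forall x \near l,
    vanish_below (- 1) (toda_Ltinv (r x) (v ^~ x)).
  by apply: filterE => x; exact: toda_Ltinv_vanish.
have [_] := is_derive_smul k Ltinv_near Lt_near derivable_toda_Ltinv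
  derivable_toda_Lt.
rewrite slambda_deriv_toda_Ltinv => E; apply: etrans (esym E) _.
rewrite -derive1E (@near_eq_derive1 _ _ (cst (smono 1 0 k : K))) ?derive1_cst//.
apply: filterS r_near => x rx.
have /(congr1 (fun y : laurent K => y k)) := divff (ltoda_neq0 (v ^~ x) rx).
exact.
Qed.
End TodaSeries.

(** * The Lax equations as identities of Laurent series *)

Section LaxEquations.
Variable K : numFieldType.
Implicit Types (f h df dh b x : laurent K).

Lemma swdw_srefl f : swdw (srefl f) = srefl (- lwdw f).
Proof.
by apply/funext => k; rewrite /srefl lcoefN lcoef_lwdwE mulrNz mulNr opprK.
Qed.

Lemma lwdwV h : h != 0 -> lwdw h^-1 = - (lwdw h / h ^+ 2).
Proof.
move=> h0; have := derivationXz (@lwdwM K) (-1) h0.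
rewrite exprN1 => ->; rewrite mulN1r expr2 invfM; field; exact: h0.
Qed.

Lemma flow_inf (a a0 : K) (f df b x : laurent K) :
  srefl (lconst a * df) = (fun k => (srefl b ** srefl (lconst a0 * df)) k
    - (srefl x ** swdw (srefl f)) k) ->
  lconst a * df = lconst a0 * b * df + x * lwdw f.
Proof.
rewrite swdw_srefl -!srefl_smul -!lcoefM => /(congr1 srefl); rewrite sreflK => E.
apply/laurentP => k; rewrite E /srefl opprK lcoefD mulrN [X in _ - X]lcoefN opprK.
by rewrite [b * _]mulrCA mulrA.
Qed.

(** The equation for the reciprocal [h^-1] of the second series is rewritten for
    [h], whose derivatives are [- h ^+ 2] times those of [h^-1]. *)
Lemma flow_zero (a a0 : K) (h dh b x : laurent K) : h != 0 ->
  (lconst a * - (dh / h ^+ 2) : laurent K)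
  = (fun k => ((b : fseries K) ** (lconst a0 * - (dh / h ^+ 2) : laurent K)) k
    - ((x : fseries K) ** swdw h^-1) k) :> fseries K ->
  lconst a * dh = lconst a0 * b * dh - x * lwdw h.
Proof.
move=> h0; rewrite -lcoef_lwdw -!lcoefM lwdwV// => E.
have {}E : lconst a * - (dh / h ^+ 2)
    = b * (lconst a0 * - (dh / h ^+ 2)) - x * - (lwdw h / h ^+ 2).
  by apply/laurentP => k; rewrite E.
have h20 : - h ^- 2 != 0 by rewrite oppr_eq0 invr_eq0 expf_neq0.
apply: (mulIf h20); transitivity (lconst a * - (dh / h ^+ 2)); first by ring.
rewrite E; ring.
Qed.

Lemma peval_srefl (P : {poly K}) :
  srefl (peval P (lmono 1 (- 1))) = peval P (lmono 1 1).
Proof.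
apply/funext => k.
by rewrite /srefl lcoef_peval_w lcoef_peval_winv oppr_le0 abszN.
Qed.

Lemma lwdw_peval_w (P : {poly K}) :
  lwdw (peval P (lmono 1 1)) = peval ('X * P^`()) (lmono 1 1).
Proof.
apply/laurentP => k; rewrite lcoef_lwdwE !lcoef_peval_w.
case: ifP => k0; last by rewrite mulr0.
rewrite coefXM coef_deriv -[in LHS](gez0_abs k0).
by case: `|k|%N => [|i]; rewrite ?mul0r//= -mulr_natl.
Qed.

Lemma lwdw_peval_winv (P : {poly K}) :
  lwdw (peval P (lmono 1 (- 1))) = - peval ('X * P^`()) (lmono 1 (- 1)).
Proof.
have pE Q k : peval Q (lmono 1 (- 1)) k = peval Q (lmono 1 1) (- k) :> K.
  by rewrite -peval_srefl /srefl opprK.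
apply/laurentP => k; rewrite lcoefN lcoef_lwdwE !pE -lwdw_peval_w lcoef_lwdwE.
by rewrite mulrNz mulNr opprK.
Qed.

(** The generator [(f ^+ n)_{>0} + (f ^+ n)_0 / 2] for a series [f] in the
    inverse of the variable. *)
Definition toda_poly (n : nat) f : {poly K} :=
  \poly_(i < n.+1) ((if i == 0 then 2^-1 else 1) * (f ^+ n) (- i%:Z)).

Lemma toda_B_peval n f : vanish_below (- 1) f ->
  toda_B n (srefl f) = peval (toda_poly n f) (lmono 1 1).
Proof.
move=> f0; apply/funext => k; rewrite lcoef_peval_w /toda_B /sproj -srefl_spow -lcoefX.
rewrite /srefl coef_poly; have fn0 := vanish_belowX (n := n) f0.
case: (ltgtP k 0) => k0; rewrite ?mulr0 ?addr0//.
  rewrite ltnS; case: ifP => kn; last by apply: fn0; rewrite mulNrn natz; lia.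
  by rewrite ifN ?mul1r ?gez0_abs//; [rewrite ltW|lia].
by rewrite k0 add0r.
Qed.

Lemma toda_Bt_srefl n (a : fseries K) : toda_Bt n a = srefl (toda_B n (srefl a)).
Proof.
apply/funext => k; rewrite /srefl /toda_B /toda_Bt /sproj -srefl_spow /srefl.
by rewrite opprK oppr_gt0 oppr_eq0.
Qed.

Lemma toda_B_support n f k : vanish_below (- 1) f -> ~~ (0 <= k <= n%:Z) ->
  toda_B n (srefl f) k = 0.
Proof.
move=> f0 kn; rewrite toda_B_peval// lcoef_peval_w; case: ifP => // k0.
by rewrite coef_poly ifN//; lia.
Qed.

Lemma euler_toda_poly n f s : s * (toda_poly n f)^`().[s] = faber_euler f n s.
Proof.
rewrite (@horner_coef_wide _ n); last first.
  apply: leq_trans (size_poly _ _) _; rewrite -ltnS.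
  by have : (size (toda_poly n f) <= n.+1)%N := size_poly _ _; case: (size _).
rewrite mulr_sumr; apply: eq_bigr => i _.
rewrite coef_deriv coef_poly ltnS ltn_ord /= mul1r -mulr_natl exprS; ring.
Qed.
End LaxEquations.

(** * The Loewner equations *)

Section LoewnerEquations.
Variable K : numFieldType.
Implicit Types (f h df dh : laurent K).
Let w : laurent K := lmono 1 1.
Let w1 : laurent K := lmono 1 (- 1).

Lemma kernel_zeroE (s : K) : kernel_zero s = (lconst s + w) / (lconst s - w).
Proof. by []. Qed.

Lemma kernel_infE (s : K) :
  kernel_inf s = srefl ((lconst s + w1) / (lconst s - w1)).
Proof.
rewrite /kernel_inf.
rewrite (_ : (fun k => smono s 0 k + _) = srefl (lconst s + w1)); last first.
  by apply/funext => k; rewrite /srefl lcoefD !lmonoE /smono oppr_eq0 eqr_opp.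
rewrite (_ : (fun k => smono s 0 k - _) = srefl (lconst s - w1)); last first.
  by apply/funext => k; rewrite /srefl lcoefB !lmonoE /smono oppr_eq0 eqr_opp.
by rewrite srecip_inf_srefl ?kernel_factor_neq0// -srefl_smul -lcoefM.
Qed.

Lemma loewner_pair_inf f df (s phi : K) :
  (lconst s - w1) * df = lconst phi * (w1 + lconst s) * lwdw f ->
  srefl df = fun k => - (swdw (srefl f) ** kernel_inf s) k * phi.
Proof.
move=> Lf.
have dfE : df = lconst phi * (lwdw f * ((lconst s + w1) / (lconst s - w1))).
  have sw : lconst s - w1 != 0 by exact: kernel_factor_neq0.
  by apply: (mulfI sw); rewrite Lf; field.
apply/funext => k; rewrite swdw_srefl kernel_infE -srefl_smul -lcoefM.
by rewrite /srefl [- lwdw f * _]mulNr lcoefN opprK dfE lcoef_lconstM mulrC.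
Qed.

Lemma loewner_pair_zero h dh (s phi : K) : h != 0 ->
  (lconst s - w) * dh = - (lconst phi * (w + lconst s) * lwdw h) ->
  - (dh / h ^+ 2) = (fun k => - (swdw h^-1 ** kernel_zero s) k * phi) :> fseries K.
Proof.
move=> h0 Lh; have sw : lconst s - w != 0 by exact: kernel_factor_neq0.
have dhE : dh = - (lconst phi * (lwdw h * ((lconst s + w) / (lconst s - w)))).
  by apply: (mulfI sw); rewrite Lh; field.
apply/funext => k; rewrite kernel_zeroE -lcoef_lwdw -lcoefM lwdwV//.
rewrite [- (lwdw h / _) * _]mulNr [in RHS]lcoefN opprK [RHS]mulrC.
by rewrite -lcoef_lconstM; congr (lcoef _ k);
  rewrite dhE; field; rewrite h0 sw.
Qed.
End LoewnerEquations.

(** * Reductions of the dispersionless Toda hierarchy *)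

Section TimeDerivative.
Variables (K : numFieldType) (D : set (times K)).
Hypothesis D_open : time_open D.

Lemma set_time_id (t : times K) n : set_time t n (t n) = t.
Proof. by apply/funext => m; rewrite /set_time; case: eqP => // ->. Qed.

Lemma time_deriv0 n (t : times K) : time_deriv n (fun=> 0) t = 0.
Proof. exact: derive1_cst. Qed.

Lemma time_deriv_comp (lam c : times K -> K) (C : K -> K) n t :
  D t -> (forall s, D s -> c s = C (lam s)) ->
  time_derivable n lam t -> derivable C (lam t) 1 ->
  time_deriv n c t = derive1 C (lam t) * time_deriv n lam t.
Proof.
move=> Dt cC dlam dC; rewrite /time_deriv.
rewrite (@near_eq_derive1 _ _ (C \o fun x => lam (set_time t n x))); last first.
  by apply: filterS (D_open Dt n) => x; exact: cC.
by rewrite derive1_comp_numField// ?set_time_id.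
Qed.
End TimeDerivative.

Section TodaReduction.
Variables (K : numFieldType) (D : set (times K)) (rt : times K -> K).
Variables (ut vt : nat -> times K -> K) (Lam : set K) (r : K -> K).
Variables (u v : nat -> K -> K) (lam : times K -> K).
Hypotheses (D_open : time_open D) (Lam_open : open Lam).
Hypothesis sol : dToda_solution D rt ut vt.
Hypothesis lam_Lam : forall t, D t -> Lam (lam t).
Hypothesis lam_derivable : forall t, D t -> forall n, time_derivable n lam t.
Hypothesis coef_derivable : forall l, Lam l ->
  [/\ derivable r l 1, forall k, derivable (u k) l 1 &
      forall k, derivable (v k) l 1].
Hypothesis reduction_L : forall t, D t ->
  toda_L (rt t) (ut ^~ t) = toda_L (r (lam t)) (u ^~ (lam t)).
Hypothesis reduction_Ltinv : forall t, D t ->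
  toda_Ltinv (rt t) (vt ^~ t) = toda_Ltinv (r (lam t)) (v ^~ (lam t)).
Hypothesis r_neq0 : forall l, Lam l -> r l != 0.
Hypothesis L_effective : forall l, Lam l ->
  [\/ derive1 r l != 0, exists k, derive1 (u k) l != 0 |
      exists k, derive1 (v k) l != 0].

Let f l := ltoda (r l) (u ^~ l).
Let h l := ltoda (r l) (v ^~ l).
Let df l := ltoda (derive1 r l) (fun k => derive1 (u k) l).
Let dh l := ltoda (derive1 r l) (fun k => derive1 (v k) l).

Let Lam_near l : Lam l -> \forall x \near l, r x != 0.
Proof.
by move=> Ll; apply: filterS (open_nbhs_nbhs (conj Lam_open Ll)) => x /r_neq0.
Qed.

Let moving l : Lam l -> ~ (df l = 0 /\ dh l = 0).
Proof.
move=> /L_effective Le [/ltoda_eq0[dr0 du0] /ltoda_eq0[_ dv0]].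
by case: Le => [|[k]|[k]]; rewrite ?dr0 ?du0 ?dv0 eqxx.
Qed.

Let stime_deriv_L n t : D t ->
  stime_deriv n (fun s => toda_L (rt s) (ut ^~ s)) t
  = srefl (lconst (time_deriv n lam t) * df (lam t)).
Proof.
move=> Dt; have [dr du dv] := coef_derivable (lam_Lam Dt).
apply/funext => k; rewrite /stime_deriv /srefl lcoef_lconstM.
rewrite (@time_deriv_comp _ _ D_open lam _
  (fun l => toda_Ltinv (r l) (u ^~ l) (- k)))//.
- rewrite mulrC -[derive1 _ _]/(slambda_deriv
    (fun l => toda_Ltinv (r l) (u ^~ l)) _ _).
  by rewrite slambda_deriv_toda_Ltinv.
- by move=> s Ds; rewrite reduction_L// toda_L_srefl.
- exact: lam_derivable.
- exact: derivable_toda_Ltinv.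
Qed.

Let stime_deriv_Lt n t : D t ->
  stime_deriv n (fun s => toda_Lt (rt s) (vt ^~ s)) t
  = (lconst (time_deriv n lam t) * - (dh (lam t) / h (lam t) ^+ 2) : laurent K).
Proof.
move=> Dt; have Ll := lam_Lam Dt; have [dr du dv] := coef_derivable Ll.
apply/funext => k; rewrite /stime_deriv lcoef_lconstM.
rewrite (@time_deriv_comp _ _ D_open lam _ (fun l => toda_Lt (r l) (v ^~ l) k))//.
- rewrite mulrC -[derive1 _ _]/(slambda_deriv
    (fun l => toda_Lt (r l) (v ^~ l)) _ _).
  by rewrite slambda_deriv_toda_Lt//; exact: Lam_near.
- by move=> s Ds; rewrite /toda_Lt reduction_Ltinv.
- exact: lam_derivable.
- by apply: derivable_toda_Lt => //; exact: Lam_near.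
Qed.

(** The exponents of a Hamiltonian lie in a fixed range, whatever the values of
    the times, and so do those of its derivatives. *)
Let B_deriv n t : exists2 X : {poly K}, (size X <= n.+1)%N &
  stime_deriv 0 (fun s => toda_B n (toda_L (rt s) (ut ^~ s))) t
  = peval X (lmono 1 1).
Proof.
set b := stime_deriv _ _ _; exists (\poly_(i < n.+1) b i%:Z).
  exact: size_poly.
apply/funext => k; rewrite lcoef_peval_w coef_poly.
have b0 : ~~ (0 <= k <= n%:Z) -> b k = 0.
  move=> kn; rewrite /b /stime_deriv (_ : (fun s => _) = fun=> 0).
    exact: time_deriv0.
  apply/funext => s; rewrite toda_L_srefl; apply: toda_B_support => //.
  exact: toda_Ltinv_vanish.
case: ifP => k0; last by apply: b0; rewrite k0.
by case: ifP => kn; [rewrite gez0_abs|apply: b0; lia].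
Qed.

Let Bt_deriv n t : exists X : {poly K},
  stime_deriv 0 (fun s => toda_Bt n (toda_Ltinv (rt s) (vt ^~ s))) t
  = peval X (lmono 1 (- 1)).
Proof.
set b := stime_deriv _ _ _; exists (\poly_(i < n.+1) b (- i%:Z)).
apply/funext => k; rewrite lcoef_peval_winv coef_poly.
have b0 : ~~ (0 <= - k <= n%:Z) -> b k = 0.
  move=> kn; rewrite /b /stime_deriv (_ : (fun s => _) = fun=> 0).
    exact: time_deriv0.
  apply/funext => s; rewrite toda_Bt_srefl /srefl.
  apply: (@toda_B_support _ _ (ltoda (rt s) (vt ^~ s))) => //.
  exact: toda_Ltinv_vanish.
case: ifP => k0; last by apply: b0; lia.
case: ifP => kn; last by apply: b0; lia.
by congr b; lia.
Qed.

Let reduced_L t : D t -> toda_L (rt t) (ut ^~ t) = srefl (f (lam t)).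
Proof. by move=> Dt; rewrite reduction_L// toda_L_srefl. Qed.

Let reduced_Lt t : D t -> toda_Lt (rt t) (vt ^~ t) = (h (lam t))^-1.
Proof. by move=> Dt; rewrite /toda_Lt reduction_Ltinv. Qed.

Let h_neq0 t : D t -> h (lam t) != 0.
Proof. by move=> /lam_Lam /r_neq0; exact: ltoda_neq0. Qed.

Lemma flow_pos t n : D t -> (0 < n)%N ->
  exists2 X : {poly K}, (size X <= n.+1)%N &
  reduced_flow (f (lam t)) (df (lam t)) (h (lam t)) (dh (lam t))
    (time_deriv n%:Z lam t) (time_deriv 0 lam t) (toda_poly n (f (lam t))) X.
Proof.
move=> Dt n0; have [X sX XE] := B_deriv n t; exists X => //.
have [_ _ /(_ t Dt n n0) [EL _ ELt _]] := sol.
have f0 : vanish_below (- 1) (f (lam t)) by exact: toda_Ltinv_vanish.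
move: EL ELt; rewrite /poisson XE !stime_deriv_L// !stime_deriv_Lt//.
rewrite reduced_L// reduced_Lt// toda_B_peval//.
set P := toda_poly _ _ => EL ELt; split.
  apply: flow_inf; rewrite EL -!lcoef_lwdw lwdw_peval_w.
  by rewrite -!peval_srefl.
apply: flow_zero; first exact: h_neq0.
by rewrite ELt -!lcoef_lwdw lwdw_peval_w.
Qed.

Lemma flow_neg t n : D t -> (0 < n)%N -> exists X : {poly K},
  reduced_flow (h (lam t)) (dh (lam t)) (f (lam t)) (df (lam t))
    (time_deriv (- n%:Z) lam t) (- time_deriv 0 lam t)
    (toda_poly n (h (lam t))) X.
Proof.
move=> Dt n0; have [X XE] := Bt_deriv n t; exists (- X).
have [_ _ /(_ t Dt n n0) [_ EL _ ELt]] := sol.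
have h0 : vanish_below (- 1) (h (lam t)) by exact: toda_Ltinv_vanish.
move: EL ELt; rewrite /poisson XE !stime_deriv_L// !stime_deriv_Lt//.
rewrite reduced_L// reduced_Lt// reduction_Ltinv// toda_Bt_srefl.
rewrite -[toda_Ltinv _ _]/(h (lam t) : fseries K) toda_B_peval//.
set P := toda_poly _ _ => EL ELt; split.
  have -> : lconst (time_deriv (- n%:Z) lam t) * dh (lam t)
      = lconst (time_deriv 0 lam t) * lwdw (peval P (lmono 1 (- 1))) * dh (lam t)
        - peval X (lmono 1 (- 1)) * lwdw (h (lam t)).
    apply: flow_zero; first exact: h_neq0.
    by rewrite ELt -peval_srefl sreflK -!lcoef_lwdw.
  by rewrite rmorphN pevalN lwdw_peval_winv mulrN !mulNr.
have -> : lconst (time_deriv (- n%:Z) lam t) * df (lam t)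
    = lconst (time_deriv 0 lam t) * (- lwdw (peval P (lmono 1 1))) * df (lam t)
      + peval X (lmono 1 1) * lwdw (f (lam t)).
  apply: flow_inf; rewrite EL -(peval_srefl X) sreflK.
  by rewrite [swdw (srefl (peval P _))]swdw_srefl.
by rewrite rmorphN pevalN lwdw_peval_w mulrN !mulNr opprK.
Qed.

Lemma speed_stationary t n : D t -> time_deriv 0 lam t = 0 ->
  time_deriv n lam t = 0.
Proof.
move=> Dt a00; have mv := moving (lam_Lam Dt); have rt0 := r_neq0 (lam_Lam Dt).
have b0 w c : vanish_below (- 1) (ltoda w c : laurent K).
  exact: toda_Ltinv_vanish.
case: n => [[|n]|n] //.
  have [X _] := flow_pos Dt (ltn0Sn n); rewrite a00 => flow.
  by apply: (reduced_flow_stationary (r := r (lam t))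
    (dr := derive1 r (lam t))) flow => //; exact: b0.
have [X] := flow_neg Dt (ltn0Sn n); rewrite a00 oppr0 => flow.
have mv' : ~ (dh (lam t) = 0 /\ df (lam t) = 0) by move=> [? ?]; exact: mv.
by apply: (reduced_flow_stationary (r := r (lam t))
    (dr := derive1 r (lam t))) flow => //; exact: b0.
Qed.

(** A formula in [l] alone: distinct points of a level set of [lambda] give the
    same value. *)
Let sigma l : K := derive1 (u 0%N) l / (derive1 r l *+ 2).

Lemma reduced_loewner t : D t -> time_deriv 0 lam t != 0 ->
  let l := lam t in
  [/\ derive1 r l != 0, sigma l != 0 &
      loewner_pair (f l) (df l) (h l) (dh l) (sigma l) (dlog r l)].
Proof.
move=> Dt a0 /=; have [X sX] := flow_pos Dt (isT : (0 < 1)%N).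
have -> : toda_poly 1 (f (lam t))
    = r (lam t) *: 'X + (2^-1 * f (lam t) 0)%:P.
  apply/polyP => i; rewrite coef_poly expr1 coefD coefZ coefX coefC.
  by case: i => [|[|i]]; rewrite ?mulr0 ?add0r ?addr0 ?mul1r ?mulr1.
have b0 w c : vanish_below (- 1) (ltoda w c : laurent K).
  exact: toda_Ltinv_vanish.
have rt0 := r_neq0 (lam_Lam Dt); have mv := moving (lam_Lam Dt).
by apply: (reduced_flow1 (r := r (lam t)) (dr := derive1 r (lam t))) => //; exact: b0.
Qed.

Lemma speed_pos t n : D t -> (0 < n)%N -> time_deriv 0 lam t != 0 ->
  time_deriv n%:Z lam t
  = faber_euler (f (lam t)) n (sigma (lam t)) * time_deriv 0 lam t.
Proof.
move=> Dt n0 a0; have [dr0 s0 [_ Lh]] := reduced_loewner Dt a0.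
have rl := r_neq0 (lam_Lam Dt).
have [X _ [_ Eh]] := flow_pos Dt n0.
rewrite -euler_toda_poly mulrC.
apply: (reduced_flow_speed (ltodaN1 _ _) rl s0 _ Lh Eh) => //.
by rewrite /dlog mulf_neq0 ?invr_eq0.
Qed.

(** The Loewner equation of [f] with parameter [s] has, up to the factor [w / s],
    the form of the equation of [h] with parameter [s^-1]; this is where the
    exchange of the two series sends [s] to [s^-1]. *)
Lemma speed_neg t n : D t -> (0 < n)%N -> time_deriv 0 lam t != 0 ->
  time_deriv (- n%:Z) lam t
  = - faber_euler (h (lam t)) n (sigma (lam t))^-1 * time_deriv 0 lam t.
Proof.
move=> Dt n0 a0; have [dr0 s0 [Lf _]] := reduced_loewner Dt a0.
have rl := r_neq0 (lam_Lam Dt).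
have [X [_ Ef]] := flow_neg Dt n0.
rewrite -euler_toda_poly mulNr mulrC -mulNr.
have sV0 : (sigma (lam t))^-1 != 0 by rewrite invr_eq0.
set s := sigma _ in s0 sV0 Lf *; set phi := dlog _ _ in Lf.
have phi0 : phi != 0 by rewrite /phi /dlog mulf_neq0 ?invr_eq0.
suff Lf' : (lconst s^-1 - lmono 1 1) * df (lam t)
    = - (lconst phi * (lmono 1 1 + lconst s^-1) * lwdw (f (lam t))).
  exact: (reduced_flow_speed (ltodaN1 _ _) rl sV0 phi0 Lf' Ef).
have ss : lconst s^-1 * lconst s = 1 :> laurent K by rewrite -rmorphM mulVf.
have ww : lmono 1 1 * lmono 1 (- 1) = 1 :> laurent K by rewrite lmonoM mulr1.
transitivity (- (lconst s^-1 * lmono 1 1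
    * ((lconst s - lmono 1 (- 1)) * df (lam t)))).
  transitivity (- ((lconst s^-1 * lconst s * lmono 1 1
    - lconst s^-1 * (lmono 1 1 * lmono 1 (- 1))) * df (lam t))); last by ring.
  rewrite ss ww; ring.
rewrite Lf; transitivity (- (lconst phi
    * (lconst s^-1 * (lmono 1 1 * lmono 1 (- 1))
       + lconst s^-1 * lconst s * lmono 1 1) * lwdw (f (lam t)))); first by ring.
rewrite ss ww; ring.
Qed.
End TodaReduction.

Theorem proposition5p6 (K : numFieldType)
    (D : set (times K)) (rt : times K -> K) (ut vt : nat -> times K -> K)
    (Lam : set K) (r : K -> K) (u v : nat -> K -> K) (lam : times K -> K)
    (D_open : time_open D)
    (Lam_open : open Lam)
    (sol : dToda_solution D rt ut vt)
    (lam_Lam : forall t, D t -> Lam (lam t))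
    (lam_derivable : forall t, D t -> forall n, time_derivable n lam t)
    (coef_derivable : forall l, Lam l ->
      [/\ derivable r l 1, forall k, derivable (u k) l 1 &
          forall k, derivable (v k) l 1])
    (reduction_L : forall t, D t ->
      toda_L (rt t) (ut ^~ t) = toda_L (r (lam t)) (u ^~ (lam t)))
    (reduction_Ltinv : forall t, D t ->
      toda_Ltinv (rt t) (vt ^~ t) = toda_Ltinv (r (lam t)) (v ^~ (lam t)))
    (lam_effective : forall l, Lam l ->
      exists2 t, D t /\ lam t = l & exists n, time_deriv n lam t != 0)
    (L_effective : forall l, Lam l ->
      [\/ derive1 r l != 0, exists k, derive1 (u k) l != 0 |
          exists k, derive1 (v k) l != 0]) :
  let L := fun l => toda_L (r l) (u ^~ l) in
  let Lt := fun l => toda_Lt (r l) (v ^~ l) in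
  exists sigma : K -> K,
    (forall l, Lam l ->
      [/\ sigma l != 0, loewner_inf r L (sigma l) l &
          loewner_zero r Lt (sigma l) l]) /\
    (forall p pt : K -> fseries K,
      (forall l, Lam l ->
        is_inverse_inf (r l) (L l) (p l) /\
        is_inverse_zero (r l) (Lt l) (pt l)) ->
      forall t, D t -> forall n : int,
        time_deriv n lam t =
          xi (r (lam t)) (p (lam t)) (pt (lam t)) (sigma (lam t)) n
          * time_deriv 0 lam t).
Proof.
have r_neq0 l : Lam l -> r l != 0.
  move=> /lam_effective[t [Dt <-] _]; case: sol => /(_ t Dt) rt0 _ _.
  have /(congr1 (fun a : fseries K => a 1)) := reduction_L t Dt.
  by rewrite /toda_L /= => <-.
have a0_neq0 t n : D t -> time_deriv n lam t != 0 -> time_deriv 0 lam t != 0.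
  move=> Dt; apply: contra_neq => a00.
  exact: (speed_stationary D_open Lam_open sol lam_Lam lam_derivable
    coef_derivable reduction_L reduction_Ltinv r_neq0 L_effective n Dt a00).
exists (fun l => derive1 (u 0%N) l / (derive1 r l *+ 2)); split.
  move=> l Ll; have [t [Dt tl] [n an]] := lam_effective l Ll.
  have := reduced_loewner D_open Lam_open sol lam_Lam lam_derivable
    coef_derivable reduction_L reduction_Ltinv r_neq0 L_effective Dt
    (a0_neq0 _ _ Dt an).
  have [dr du dv] := coef_derivable l Ll.
  have r_near : \forall x \near l, r x != 0.
    by apply: filterS (open_nbhs_nbhs (conj Lam_open Ll)) => x /r_neq0.
  rewrite tl => -[dr0 s0 [Lf Lh]]; split=> //.
    rewrite /loewner_inf [toda_L (r l) _]toda_L_srefl -(loewner_pair_inf Lf).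
    apply/funext => k; rewrite /srefl -slambda_deriv_toda_Ltinv /slambda_deriv.
    by congr (derive1 _ l); apply/funext => m; rewrite toda_L_srefl.
  rewrite /loewner_zero slambda_deriv_toda_Lt//.
  apply: loewner_pair_zero Lh; exact: ltoda_neq0 (r_neq0 _ Ll).
move=> p pt inv t Dt n; have Ll := lam_Lam t Dt.
have [a00|a0] := eqVneq (time_deriv 0 lam t) 0.
  rewrite a00 mulr0; exact: (speed_stationary D_open Lam_open sol lam_Lam
    lam_derivable coef_derivable reduction_L reduction_Ltinv r_neq0
    L_effective n Dt a00).
have [_ s0 _] := reduced_loewner D_open Lam_open sol lam_Lam lam_derivable
  coef_derivable reduction_L reduction_Ltinv r_neq0 L_effective Dt a0.
have [pinv ptinv] := inv _ Ll; rewrite toda_L_srefl in pinv.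
pose f := ltoda (r (lam t)) (u ^~ (lam t)).
pose h := ltoda (r (lam t)) (v ^~ (lam t)).
rewrite (@xiE _ _ f h _ _ _ (toda_Ltinv_vanish _ _) (toda_Ltinv_vanish _ _)
  (ltodaN1 _ _) (r_neq0 _ Ll) s0 pinv ptinv).
case: n => [[|n]|n]; first by rewrite mul1r.
  exact: (speed_pos D_open Lam_open sol lam_Lam lam_derivable coef_derivable
    reduction_L reduction_Ltinv r_neq0 L_effective Dt (ltn0Sn n) a0).
exact: (speed_neg D_open Lam_open sol lam_Lam lam_derivable coef_derivable
  reduction_L reduction_Ltinv r_neq0 L_effective Dt (ltn0Sn n) a0).
Qed.
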